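(* Timeline Vertex Cover is NP-hard, even when restricted to instances with $k=2$, $\ell=0$, $\mathrm{imw}=4$, in which each edge of the underlying graph appears in exactly one snapshot and the underlying graph has maximum degree bounded by a constant.
   Context: A temporal graph $\mathcal{G}=(G_1,\dots,G_T)$ is a finite sequence of simple undirected graphs (snapshots) on a common finite vertex set $V$, $E_i=E(G_i)$; its underlying graph is $(V,E_\downarrow)$ with $E_\downarrow=\bigcup_i E_i$. A temporal edge is $(e,i)$ with $e\in E_i$. An activity interval is a triple $(v,a,b)$ with $v\in V$, $1\le a\le b\le T$; its length is $b-a$. A $k$-activity $\ell$-timeline is a set of activity intervals with at most $k$ intervals per vertex, each of length at most $\ell$. A vertex $v$ is active at time $i$ if some $(v,a,b)$ in the timeline has $a\le i\le b$; the timeline covers $(uv,i)$ if $u$ or $v$ is active at time $i$. Timeline Vertex Cover: given $\mathcal{G}$ and integers $k\ge1,\ell\ge0$, decide whether some $k$-activity $\ell$-timeline covers all temporal edges. The interval-membership sequence is $(F_i)_{i\in[T]}$ with $F_i=\{e\in E_\downarrow:\exists p\le i\le q,\ e\in E_p\cap E_q\}$, and the interval-membership-width is $\mathrm{imw}(\mathcal{G})=\max_i|F_i|$. *)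

(* Defs.v *)
From HB Require Import structures.
From mathcomp Require Import all_boot all_order all_algebra.

Set Implicit Arguments.
Unset Strict Implicit.
Unset Printing Implicit Defensive.

(** * Polynomial time, NP and NP-hardness

    The model is the deterministic multi-tape Turing machine with two-way
    infinite tapes over an arbitrary finite alphabet. *)

Inductive move := MoveL | MoveS | MoveR.

Definition shift (m : move) : int :=
  match m with MoveL => (- 1)%R | MoveS => 0%R | MoveR => 1%R end.

Record TM := MkTM {
  tm_state : finType;
  tm_sym : finType;
  tm_tapes : nat;  (* the machine has [tm_tapes.+1] tapes *)
  tm_start : tm_state;
  tm_halt : pred tm_state;
  tm_blank : tm_sym;
  tm_bit : bool -> tm_sym;
  tm_bit_inj : injective tm_bit;
  tm_bit_blank : forall b, tm_bit b != tm_blank;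
  tm_delta : tm_state -> {ffun 'I_tm_tapes.+1 -> tm_sym} ->
             tm_state * {ffun 'I_tm_tapes.+1 -> tm_sym * move} }.

Record config (M : TM) := Config {
  c_state : tm_state M;
  c_tape : 'I_(tm_tapes M).+1 -> int -> tm_sym M;
  c_head : 'I_(tm_tapes M).+1 -> int }.

(* [w] written on the cells 0, ..., size w - 1, all other cells blank. *)
Definition word_tape (M : TM) (w : seq bool) (z : int) : tm_sym M :=
  if z is Posz i then nth (tm_blank M) (map (@tm_bit M) w) i else tm_blank M.

Definition init_config (M : TM) (w : seq bool) : config M :=
  Config (tm_start M)
         (fun j => word_tape M (if j == ord0 then w else [::]))
         (fun=> 0%R).

(* Halting configurations are fixed points of [step]. *)
Definition step (M : TM) (c : config M) : config M :=
  if tm_halt (c_state c) then c else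
  let: (q, act) :=
    tm_delta (c_state c) [ffun j => c_tape c j (c_head c j)] in
  Config q
         (fun j z => if z == c_head c j then (act j).1 else c_tape c j z)
         (fun j => c_head c j + shift (act j).2)%R.

(* Input on the first tape, output on the last one (the same tape when there is
   only one). Since halting configurations are fixed, this says that [M] halts
   after at most [t (size w)] steps. *)
Definition computes_in_time (M : TM) (f : seq bool -> seq bool)
    (t : nat -> nat) : Prop :=
  forall w : seq bool,
    let c := iter (t (size w)) (@step M) (init_config M w) in
    tm_halt (c_state c) /\ forall z, c_tape c ord_max z = word_tape M (f w) z.

Definition polynomial_time (f : seq bool -> seq bool) : Prop :=
  exists (M : TM) (c d : nat), computes_in_time M f (fun n => c * n ^ d + c).

(* Self-delimiting code: a bit 1 before every bit of [w], then a final 0. *)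
Definition delimit (w : seq bool) : seq bool :=
  flatten [seq [:: true; b] | b <- w] ++ [:: false].

Definition pair_code (x y : seq bool) : seq bool := delimit x ++ y.

Definition NP (L : seq bool -> Prop) : Prop :=
  exists (V : seq bool -> bool) (c d : nat),
    polynomial_time (fun w => [:: V w]) /\
    forall x, L x <->
      exists y, size y <= c * size x ^ d + c /\ V (pair_code x y).

Record decision_problem := DecisionProblem {
  instance : Type;
  encode : instance -> seq bool;
  yes_instance : instance -> Prop }.

(* NP-hardness of [P] restricted to the instances satisfying [D]: the reductions
   only produce instances satisfying [D]. *)
Definition NP_hard_on (P : decision_problem) (D : instance P -> Prop) : Prop :=
  forall L, NP L ->
    exists f : seq bool -> instance P,
      [/\ polynomial_time (fun x => encode (f x)),
          forall x, D (f x)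
        & forall x, L x <-> yes_instance (f x)].

(** * Temporal graphs

    Times are numbered 0, ..., T - 1, and a simple undirected graph on [V] is
    given by its set of edges, which are two-element subsets of [V]. *)

Record temporal_graph (V : finType) (T : nat) := TemporalGraph {
  snapshot : 'I_T -> {set {set V}};
  snapshot_simple : forall i e, e \in snapshot i -> #|e| = 2 }.

Section TemporalGraph.
Variables (V : finType) (T : nat) (G : temporal_graph V T).

Definition underlying_edges : {set {set V}} := \bigcup_(i < T) snapshot G i.

Definition underlying_degree (v : V) : nat :=
  #|[set e in underlying_edges | v \in e]|.

Definition interval_membership (i : 'I_T) : {set {set V}} :=
  [set e in underlying_edges | [exists p : 'I_T, exists q : 'I_T,
     (p <= i <= q) && (e \in snapshot G p :&: snapshot G q)]].

Definition imw : nat := \max_(i < T) #|interval_membership i|.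

Definition each_edge_once : Prop :=
  forall e, e \in underlying_edges -> #|[set i | e \in snapshot G i]| = 1.

(* The triple [(v, a, b)] is an activity interval when [a <= b]. *)
Definition is_timeline (k l : nat) (S : {set V * 'I_T * 'I_T}) : Prop :=
  [/\ forall v a b, (v, a, b) \in S -> a <= b,
      forall v a b, (v, a, b) \in S -> b - a <= l
    & forall v, #|[set I in S | I.1.1 == v]| <= k].

Definition active (S : {set V * 'I_T * 'I_T}) (v : V) (i : 'I_T) : Prop :=
  exists a b : 'I_T, (v, a, b) \in S /\ a <= i <= b.

Definition covers_all (S : {set V * 'I_T * 'I_T}) : Prop :=
  forall i e, e \in snapshot G i -> exists2 v, v \in e & active S v i.

End TemporalGraph.

(** * Timeline Vertex Cover *)

Record tvc_instance := TVCInstance {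
  tvc_n : nat;
  tvc_T : nat;
  tvc_graph : temporal_graph 'I_tvc_n tvc_T;
  tvc_k : nat;
  tvc_l : nat;
  tvc_k_gt0 : 0 < tvc_k }.

(* Binary digits, least significant first; [:: false] for 0. *)
Definition binary (m : nat) : seq bool :=
  mkseq (fun i => odd (m %/ 2 ^ i)) (trunc_log 2 m).+1.

Definition unary (m : nat) : seq bool := rcons (nseq m true) false.

(* The numbers of vertices and of snapshots in unary, [k] and [l] in binary, then
   the adjacency matrices of the snapshots, row by row. *)
Definition tvc_encode (I : tvc_instance) : seq bool :=
  unary (tvc_n I) ++ unary (tvc_T I) ++
  delimit (binary (tvc_k I)) ++ delimit (binary (tvc_l I)) ++
  flatten [seq flatten [seq [seq [set u; v] \in snapshot (tvc_graph I) i
                              | v <- enum 'I_(tvc_n I)]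
                         | u <- enum 'I_(tvc_n I)]
            | i <- enum 'I_(tvc_T I)].

Definition tvc_yes (I : tvc_instance) : Prop :=
  exists S, is_timeline (tvc_k I) (tvc_l I) S /\ covers_all (tvc_graph I) S.

Definition timeline_vertex_cover : decision_problem :=
  DecisionProblem tvc_encode tvc_yes.

(* Main.v *)
From HB Require Import structures.
Require Import Defs.
From Stdlib Require Import FunctionalExtensionality.
From mathcomp Require Import all_boot all_order all_algebra zify ring.

Set Implicit Arguments.
Unset Strict Implicit.
Unset Printing Implicit Defensive.

(** An accepting computation of a verifier is a tiling of a grid in which every tile
    carries the state, the scanned symbols and, for each tape, the symbol of its cell
    and the side on which the head lies; all constraints then relate horizontal or
    vertical neighbours, and only the labels of the first row depend on the input.

    Tilings become timelines as follows. With two activity points per vertex, a vertex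
    with edges in three snapshots is inactive in one of them, and an inactive vertex
    forces its neighbours of that snapshot to be active. So such vertices express
    clauses, stars copy a truth value, and a vertex also joined to an exhausted vertex
    relays a truth value or, as the common neighbour of two tiles, forbids that pair.
    Exhausted vertices come from a complete graph on five vertices whose ten edges lie
    in ten snapshots: its ten activity points are all needed there.

    Each snapshot of a cell only involves that cell, the next one and the one below.
    So the instance is printed by nested loops over the tapes of a multi-tape machine,
    and such loops run in polynomial time whatever they print: it suffices to know
    which words they write. *)

(** * Polynomially bounded functions *)

Definition poly_bounded (f : nat -> nat) : Prop :=
  exists c d, forall n, f n <= c * n.+1 ^ d.

Lemma poly_bounded_const c : poly_bounded (fun=> c).
Proof. by exists c, 0 => n; rewrite expn0 muln1. Qed.

Lemma poly_bounded_id : poly_bounded id.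
Proof. by exists 1, 1 => n; rewrite expn1 mul1n. Qed.

Lemma poly_boundedD f g :
  poly_bounded f -> poly_bounded g -> poly_bounded (fun n => f n + g n).
Proof.
move=> [c [d cd]] [c' [d' cd']]; exists (c + c'), (d + d') => n; rewrite mulnDl.
apply: leq_add; [apply: leq_trans (cd n) _ | apply: leq_trans (cd' n) _];
  by rewrite leq_mul2l leq_pexp2l ?leq_addr ?leq_addl ?orbT.
Qed.

Lemma poly_boundedM f g :
  poly_bounded f -> poly_bounded g -> poly_bounded (fun n => f n * g n).
Proof.
move=> [c [d cd]] [c' [d' cd']]; exists (c * c'), (d + d') => n.
by rewrite expnD mulnACA leq_mul.
Qed.

Ltac poly_bounds := repeat first
  [assumption | exact: poly_bounded_const | apply: poly_boundedD | apply: poly_boundedM].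

Lemma poly_boundedP f :
  poly_bounded f -> exists c d, forall n, f n <= c * n ^ d + c.
Proof.
move=> [c [d cd]]; exists (c * 2 ^ d), d => n; apply: leq_trans (cd n) _.
case: n => [|n]; first by rewrite exp1n muln1 (leq_trans _ (leq_addl _ _)) // leq_pmulr ?expn_gt0.
rewrite -mulnA -expnMn (leq_trans _ (leq_addr _ _)) // leq_mul2l.
by case: d {cd} => [|d]; rewrite ?expn0 ?leq_exp2r ?orbT //; apply/orP; right; lia.
Qed.

(** * Programs for multi-tape machines *)

Section Tapes.
Variables (I : eqType) (B : Type).

(* The word on each tape starts at cell 0; every other cell is blank, and a blank
   reads as [None]. *)
Definition tapes := I -> seq B * int.

Definition cell (w : seq B) (z : int) : option B := if z is Posz i then onth w i else None.

Definition readings (s : tapes) (i : I) : option B := cell (s i).1 (s i).2.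

Definition update (s : tapes) (k : I) (x : seq B * int) : tapes :=
  fun i => if i == k then x else s i.

Definition at_end (s : tapes) (k : I) : Prop := (s k).2 = Posz (size (s k).1).

Definition emit (s : tapes) (k : I) (u : seq B) : tapes :=
  update s k ((s k).1 ++ u, ((s k).2 + Posz (size u))%R).

Definition dir (b : bool) : int := if b then 1%R else (- 1)%R.

Definition offset (l : seq (I * bool)) (i : I) : int :=
  foldr (fun m z => ((if i == m.1 then dir m.2 else 0) + z)%R) 0%R l.

Definition slides (l : seq (I * bool)) (z : int) (s : tapes) : tapes :=
  fun i => ((s i).1, (s i).2 + z * offset l i)%R.

Lemma cell_rcons w c z :
  cell (rcons w c) z = if z == Posz (size w) then Some c else cell w z.
Proof.
case: z => [i|i] //=; rewrite -cats1 onth_cat.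
have -> : (Posz i == Posz (size w)) = (i == size w) by [].
case: ltngtP => [//|gt|->]; last by rewrite subnn.
by rewrite !onth_default //= ?subn_gt0 // ltnW.
Qed.

Lemma emit0 s k : emit s k [::] = s.
Proof.
apply: functional_extensionality => i; rewrite /emit /update cats0 GRing.addr0.
by case: eqP => // ->; case: (s k).
Qed.

Lemma emit_cat s k u v : emit s k (u ++ v) = emit (emit s k u) k v.
Proof.
apply: functional_extensionality => i; rewrite /emit /update eqxx /=.
by case: eqP => // _; rewrite catA size_cat PoszD GRing.addrA.
Qed.

Lemma emit_other s k u i : i != k -> emit s k u i = s i.
Proof. by rewrite /emit /update => /negPf ->. Qed.

Lemma at_end_emit s k u : at_end s k -> at_end (emit s k u) k.
Proof. by rewrite /at_end /emit /update eqxx /= => ->; rewrite size_cat PoszD. Qed.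

Lemma readings_at_end s k : at_end s k -> readings s k = None.
Proof. by rewrite /readings => -> /=; rewrite onth_default. Qed.

Lemma readings_emit s k u : at_end s k -> readings (emit s k u) = readings s.
Proof.
move=> end_k; apply: functional_extensionality => i.
case: (eqVneq i k) => [->|ne]; last by rewrite /readings emit_other.
by rewrite !readings_at_end //; exact: at_end_emit.
Qed.

Lemma slides0 l s : slides l 0 s = s.
Proof.
apply: functional_extensionality => i.
by rewrite /slides GRing.mul0r GRing.addr0; case: (s i).
Qed.

Lemma slidesD l z z' s : slides l (z + z')%R s = slides l z' (slides l z s).
Proof.
by apply: functional_extensionality => i; rewrite /slides /= GRing.mulrDl GRing.addrA.
Qed.

Lemma emit_slides l z s k u : emit (slides l z s) k u = slides l z (emit s k u).
Proof.
apply: functional_extensionality => i; rewrite /emit /slides /update.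
by case: eqP => //= ->; rewrite GRing.addrAC.
Qed.

Lemma offset_notin l i : i \notin unzip1 l -> offset l i = 0%R.
Proof.
elim: l => //= m l IH; rewrite inE negb_or => /andP[/negPf -> /IH ->].
by rewrite GRing.addr0.
Qed.

Lemma slides_other l z s i : i \notin unzip1 l -> slides l z s i = s i.
Proof.
by move=> /offset_notin E; rewrite /slides E GRing.mulr0 GRing.addr0; case: (s i).
Qed.

Lemma readings_slides_head j l z s : j \notin unzip1 l -> (s j).2 = 0%R ->
  readings (slides ((j, true) :: l) z s) j = cell (s j).1 z.
Proof.
move=> jl s0; rewrite /readings /slides /= eqxx s0 offset_notin //.
by rewrite GRing.add0r GRing.addr0 GRing.mulr1.
Qed.

Definition back (l : seq (I * bool)) : seq (I * bool) := [seq (m.1, ~~ m.2) | m <- l].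

Lemma slides_back l z s : slides (back l) z s = slides l (- z)%R s.
Proof.
have offset_back i : offset (back l) i = (- offset l i)%R.
  elim: l => [|m l IH] /=; first by rewrite GRing.oppr0.
  rewrite IH GRing.opprD; case: eqP => _; last by rewrite GRing.oppr0.
  by case: m.2; rewrite /dir ?GRing.opprK.
apply: functional_extensionality => i.
by rewrite /slides offset_back GRing.mulrN GRing.mulNr.
Qed.

End Tapes.

Section Programs.
Variables (I : eqType) (B : Type).
Implicit Types (s : tapes I B) (i j k : I).

Inductive prog :=
| Append of I & ((I -> option B) -> B)
| Move of I & bool
| Skip
| Seq of prog & prog
| While of I & prog.

Inductive exec : prog -> tapes I B -> tapes I B -> nat -> Prop :=
| ExecAppend k g s : at_end s k ->
    exec (Append k g) s (emit s k [:: g (readings s)]) 1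
| ExecMove k b s : exec (Move k b) s (slides [:: (k, b)] 1 s) 1
| ExecSkip s : exec Skip s s 1
| ExecSeq p q s s1 s2 t1 t2 :
    exec p s s1 t1 -> exec q s1 s2 t2 -> exec (Seq p q) s s2 (t1 + t2)
| ExecWhileEnd j p s : readings s j = None -> exec (While j p) s s 1
| ExecWhileStep j p s s1 s2 t1 t2 : readings s j ->
    exec p s s1 t1 -> exec (While j p) s1 s2 t2 ->
    exec (While j p) s s2 (t1 + t2).+1.

Fixpoint state (p : prog) : finType :=
  match p with
  | Append _ _ | Move _ _ | Skip => unit
  | Seq p q => (state p + state q)%type
  | While _ p => option (state p)
  end.

Fixpoint entry (p : prog) : state p :=
  match p with
  | Append _ _ | Move _ _ | Skip => tt
  | Seq p q => inl (entry p)
  | While _ p => None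
  end.

Definition action := option (I * (B + bool)).

Fixpoint delta (p : prog) : state p -> (I -> option B) -> option (state p) * action :=
  match p with
  | Append k g => fun _ r => (None, Some (k, inl (g r)))
  | Move k b => fun _ _ => (None, Some (k, inr b))
  | Skip => fun _ _ => (None, None)
  | Seq p q => fun x r =>
      match x with
      | inl x => let: (y, a) := delta x r in
                 (Some (if y is Some y then inl y else inr (entry q)), a)
      | inr x => let: (y, a) := delta x r in (omap inr y, a)
      end
  | While j p => fun x r =>
      match x with
      | None => (if r j then Some (Some (entry p)) else None, None)
      | Some x => let: (y, a) := delta x r in (Some y, a)
      end
  end.

Definition perform (a : action) s : tapes I B :=
  match a with
  | None => s
  | Some (k, inl c) => emit s k [:: c]
  | Some (k, inr b) => slides [:: (k, b)] 1 s
  end.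

Definition legal (a : action) s : Prop :=
  if a is Some (k, inl _) then at_end s k else True.

Inductive path_from (p : prog) : option (state p) -> tapes I B ->
    option (state p) -> tapes I B -> nat -> Prop :=
| PathNil x s : path_from x s x s 0
| PathStep x y a s z s' t :
    delta x (readings s) = (y, a) -> legal a s ->
    path_from y (perform a s) z s' t -> path_from (Some x) s z s' t.+1.

Lemma path_trans p (x y z : option (state p)) s s1 s2 t1 t2 :
  path_from x s y s1 t1 -> path_from y s1 z s2 t2 ->
  path_from x s z s2 (t1 + t2).
Proof.
move=> xy; elim: xy z s2 t2 => //= {}x {}y a {}s z s' t E ok _ IH z' s2 t2 yz.
by rewrite addSn; apply: PathStep E ok _; apply: IH.
Qed.

Lemma path_seql p q (x y : option (state p)) s s' t :
  path_from x s y s' t ->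
  let embed u := Some (if u is Some v then inl v else inr (entry q)) in
  @path_from (Seq p q) (embed x) s (embed y) s' t.
Proof.
move=> xy embed; elim: xy => [{}x {}s|{}x {}y a {}s z {}s' {}t E ok _ IH].
  exact: PathNil.
by apply: (@PathStep (Seq p q) (inl x) (embed y) a) => //=; rewrite E.
Qed.

Lemma path_seqr p q (x y : option (state q)) s s' t :
  path_from x s y s' t ->
  @path_from (Seq p q) (omap inr x) s (omap inr y) s' t.
Proof.
elim => [{}x {}s|{}x {}y a {}s z {}s' {}t E ok _ IH]; first exact: PathNil.
by apply: (@PathStep (Seq p q) (inr x) (omap inr y) a) => //=; rewrite E.
Qed.

Lemma path_while j p (x y : option (state p)) s s' t :
  path_from x s y s' t ->
  @path_from (While j p) (Some x) s (Some y) s' t.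
Proof.
elim => [{}x {}s|{}x {}y a {}s z {}s' {}t E ok _ IH]; first exact: PathNil.
by apply: (@PathStep (While j p) (Some x) (Some y) a) => //=; rewrite E.
Qed.

Lemma exec_path p s s' t :
  exec p s s' t -> path_from (Some (entry p)) s None s' t.
Proof.
elim=> {p s s' t}.
- by move=> k g s ok; apply: PathStep; [reflexivity | exact: ok | exact: PathNil].
- by move=> k b s; apply: PathStep; [reflexivity | | exact: PathNil].
- by move=> s; apply: PathStep; [reflexivity | | exact: PathNil].
- move=> p q s s1 s2 t1 t2 _ path_p _ path_q.
  exact: path_trans (path_seql q path_p) (path_seqr p path_q).
- move=> j p s blank_j; apply: (@PathStep (While j p) None None None) => //=.
    by rewrite blank_j.
  exact: PathNil.
- move=> j p s s1 s2 t1 t2 letter_j _ path_p _ path_loop.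
  apply: (@PathStep (While j p) None (Some (Some (entry p))) None) => //=.
    by rewrite letter_j.
  exact: path_trans (path_while j path_p) path_loop.
Qed.

End Programs.

Arguments Skip {I B}.
Arguments Move {I B}.

Section TapeNumbers.
Variables (I : finType) (inp out : I).
Hypothesis inp_out : inp != out.

Definition tape_names : seq I :=
  inp :: rcons [seq i <- enum I | i \notin [:: inp; out]] out.

Definition tape_count : nat := (size tape_names).-1.

Definition tape_name (j : 'I_tape_count.+1) : I := nth inp tape_names j.

Definition tape_number (i : I) : 'I_tape_count.+1 := inord (index i tape_names).

Lemma tape_numberK : cancel tape_number tape_name.
Proof.
move=> i; have i_named : i \in tape_names.
  by rewrite inE mem_rcons inE mem_filter mem_enum !inE; case: eqP => //; case: eqP.
by rewrite /tape_name inordK ?nth_index // index_mem.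
Qed.

Lemma tape_nameK : cancel tape_name tape_number.
Proof.
move=> j; have names_uniq : uniq tape_names.
  rewrite /= mem_rcons rcons_uniq !inE !mem_filter !inE !eqxx ?orbT /= orbF.
  by rewrite inp_out filter_uniq ?enum_uniq.
apply: val_inj; rewrite /= inordK ?index_uniq //; exact: ltn_ord.
Qed.

Lemma tape_name_ord0 : tape_name ord0 = inp.
Proof. by []. Qed.

Lemma tape_name_ord_max : tape_name ord_max = out.
Proof. by rewrite /tape_name nth_last /= last_rcons. Qed.

End TapeNumbers.

Section Compilation.
Variables (I B : finType) (bit : bool -> B) (bit_inj : injective bit).
Variables (inp out : I) (inp_out : inp != out) (p : prog I B).

Local Notation name := (@tape_name I inp out).
Local Notation number := (tape_number inp out).

Definition tape_action (a : action I B) (i : I) (c : option B) : option B * move :=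
  match a with
  | Some (k, o) => if i == k then
      match o with
      | inl b => (Some b, MoveR)
      | inr b => (c, if b then MoveR else MoveL)
      end else (c, MoveS)
  | None => (c, MoveS)
  end.

Definition prog_tm : TM :=
  @MkTM (option (state p)) (option B) (tape_count inp out) (Some (entry p))
    (fun x => x == None) None (fun b => Some (bit b)) (inj_comp Some_inj bit_inj)
    (fun=> isT)
    (fun x r => match x with
       | Some x => let: (y, a) := delta x (fun i => r (number i)) in
                   (y, [ffun j => tape_action a (name j) (r j)])
       | None => (None, [ffun j => (r j, MoveS)])
       end).

Definition simulates (c : config prog_tm) (x : option (state p)) (s : tapes I B) : Prop :=
  [/\ c_state c = x,
      forall j, c_tape c j =1 cell (s (name j)).1
    & forall j, c_head c j = (s (name j)).2].

Lemma simulates_step c x s y a :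
  simulates c (Some x) s -> delta x (readings s) = (y, a) -> legal a s ->
  simulates (step c) y (perform a s).
Proof.
move=> [state_x tape_s head_s] delta_x ok.
have readings_s : (fun i => [ffun j => c_tape c j (c_head c j)] (number i)) = readings s.
  by apply: functional_extensionality => i; rewrite ffunE tape_s head_s tape_numberK.
rewrite /step state_x /= readings_s delta_x; split=> //= j; last first.
  rewrite ffunE head_s.
  case: a ok {delta_x} => [[k [c'|b]]|] /= ok; last by rewrite GRing.addr0.
    by rewrite /emit /update; case: eqP => [->|_] //=; rewrite GRing.addr0.
  by rewrite !GRing.mul1r GRing.addr0; case: eqP => // _; case: b {ok}.
move=> z; rewrite !ffunE !tape_s head_s.
have same_cell : (if z == (s (name j)).2 then cell (s (name j)).1 (s (name j)).2
                  else cell (s (name j)).1 z) = cell (s (name j)).1 z.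
  by case: eqP => // ->.
case: a ok {delta_x} => [[k [c1|b]]|] //= ok; last by case: (name j == k).
rewrite /emit /update; case: (name j =P k) => [name_j|_] //=.
by rewrite cats1 cell_rcons -ok -name_j.
Qed.

Lemma simulates_path c x s y s' t :
  simulates c x s -> path_from x s y s' t ->
  simulates (iter t (@step _) c) y s'.
Proof.
move=> + path_t; elim: path_t c => //= {}x {}y a {}s z {}s' {}t E ok _ IH c sim_c.
by rewrite -iterS iterSr; apply: IH; apply: simulates_step E ok.
Qed.

Definition input_tapes (w : seq bool) : tapes I B :=
  fun i => (if i == inp then map bit w else [::], 0%R).

Lemma prog_polynomial_time f (T : nat -> nat) : poly_bounded T ->
  (forall w, exists s t, [/\ exec p (input_tapes w) s t, t <= T (size w)
     & (s out).1 = map bit (f w)]) ->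
  polynomial_time f.
Proof.
have word_tapeE w z : word_tape prog_tm w z = cell (map bit w) z.
  by case: z => //= i; rewrite onthE -map_comp.
case/poly_boundedP=> c [d Tcd] run; exists prog_tm, c, d => w.
have [s [t [run_w le_t out_w]]] := run w; cbv zeta; set n := _ + c.
have le_n : t <= n by apply: leq_trans le_t (Tcd _).
have [] : simulates (iter t (@step _) (init_config prog_tm w)) None s.
  apply: simulates_path (exec_path run_w); split=> //= j z; rewrite word_tapeE.
  rewrite /input_tapes -(can_eq (tape_nameK inp_out)) tape_name_ord0.
  by case: eqP.
rewrite -(subnK le_n) iterD; set c' := iter t _ _ => halted tape_s _.
have -> : iter (n - t) (@step _) c' = c'.
  by elim: (n - t) => //= i ->; rewrite /step halted.
split; first by rewrite halted.
by move=> z; rewrite tape_s tape_name_ord_max out_w word_tapeE.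
Qed.

End Compilation.

(** * Loop programs that print words, and their running time *)

Lemma flatten_nseq (T : Type) (m n : nat) (a : T) : flatten (nseq n (nseq m a)) = nseq (n * m) a.
Proof. by elim: n => //= n ->; rewrite -nseqD mulSn. Qed.

Lemma flatten_nseq1 (T : Type) (n : nat) (a : T) : flatten (nseq n [:: a]) = nseq n a.
Proof. by rewrite (flatten_nseq 1) muln1. Qed.

Lemma map_const_nseq (T U : Type) (s : seq T) (a : U) : [seq a | _ <- s] = nseq (size s) a.
Proof. by elim: s => //= x s ->. Qed.

Lemma flatten_mkseq_onth (T U : Type) (w : seq T) (h : nat -> seq U) (F : T -> seq U) :
  (forall i b, onth w i = Some b -> h i = F b) ->
  flatten (mkseq h (size w)) = flatten [seq F b | b <- w].
Proof.
elim: w h => // b w IH h hF; rewrite /mkseq /= (hF 0 b erefl) -(IH (h \o succn)) => [|i c].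
  by rewrite /mkseq (iotaDl 1) -map_comp.
exact: (hF i.+1).
Qed.

Section Loops.
Variables (I : eqType) (B : Type).
Implicit Types (s : tapes I B) (j k : I) (l : seq (I * bool)).

Fixpoint moves l : prog I B :=
  if l is m :: l' then Seq (Move m.1 m.2) (moves l') else Skip.

Definition rewind j l : prog I B :=
  Seq (moves (back l)) (Seq (While j (moves (back l))) (moves l)).

(* [p] runs once for each letter of the word on tape [j]; the heads of the tapes
   listed in [l] move along with that of [j], and all of them come back at the end. *)
Definition foreach j l (p : prog I B) : prog I B :=
  let l' := (j, true) :: l in Seq (While j (Seq p (moves l'))) (rewind j l').

Lemma exec_moves l s : exec (moves l) s (slides l 1 s) (size l).+1.
Proof.
elim: l s => [|m l IH] s /=.
  rewrite (_ : slides [::] 1 s = s); first exact: ExecSkip.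
  exact: functional_extensionality (fun i => slides_other _ _ _).
have -> : slides (m :: l) 1 s = slides l 1 (slides [:: m] 1 s).
  by apply: functional_extensionality => i; rewrite /slides /=; congr pair; ring.
rewrite -[(size l).+2]add1n; apply: ExecSeq (IH _).
by case: m => k b; exact: ExecMove.
Qed.

Definition rewind_cost (d n : nat) : nat := n * (d + 2) + 2 * d + 3.

Lemma exec_rewind j l s w : s j = (w, 0%R) -> j \notin unzip1 l ->
  let l' := (j, true) :: l in
  exec (rewind j l') (slides l' (Posz (size w)) s) s (rewind_cost (size l') (size w)).
Proof.
move=> sj jl l'.
have exec_back z s' : exec (moves (back l')) (slides l' z s') (slides l' (z - 1)%R s')
    (size l').+1.
  by rewrite slidesD -slides_back -(size_map (fun m => (m.1, ~~ m.2)) l'); exact: exec_moves.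
have loop n : n <= size w -> exec (While j (moves (back l')))
    (slides l' (Posz n - 1)%R s) (slides l' (- 1)%R s) (n * (size l' + 2) + 1).
  elim: n => [|n IH] le; first by apply: ExecWhileEnd; rewrite readings_slides_head ?sj.
  have -> : n.+1 * (size l' + 2) + 1 = ((size l').+1 + (n * (size l' + 2) + 1)).+1 by lia.
  have -> : (Posz n.+1 - 1)%R = Posz n by lia.
  apply: ExecWhileStep (exec_back _ _) (IH (ltnW le)).
  by rewrite readings_slides_head ?sj //= onthTE.
rewrite (_ : rewind_cost _ _ = (size l').+1 + (size w * (size l' + 2) + 1 + (size l').+1)).
  apply: ExecSeq (exec_back _ _) _; apply: ExecSeq (loop _ (leqnn _)) _.
  rewrite -{2}(slides0 l' s) -[0%R](GRing.addNr 1%R) slidesD; exact: exec_moves.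
by rewrite /rewind_cost; lia.
Qed.

Definition emits p s k u T : Prop :=
  forall v, exists2 t, t <= T & exec p (emit s k v) (emit s k (v ++ u)) t.

Lemma emits_seq p q s k u v T1 T2 :
  emits p s k u T1 -> emits q s k v T2 -> emits (Seq p q) s k (u ++ v) (T1 + T2).
Proof.
move=> emits_p emits_q z; have [t1 le1 run1] := emits_p z.
have [t2 le2 run2] := emits_q (z ++ u); exists (t1 + t2); first exact: leq_add.
by rewrite catA; apply: ExecSeq run1 run2.
Qed.

Definition foreach_cost (d n T : nat) : nat := n * (T + d + 2) + 1 + rewind_cost d n.

Lemma emits_foreach j l p s k w h T :
  s j = (w, 0%R) -> j != k -> j \notin unzip1 l ->
  (forall i, i < size w -> emits p (slides ((j, true) :: l) (Posz i) s) k (h i) T) ->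
  emits (foreach j l p) s k (flatten (mkseq h (size w)))
    (foreach_cost (size l).+1 (size w) T).
Proof.
move=> sj jk jl emits_p v; rewrite /foreach; set l' := (j, true) :: l in emits_p *.
have loop r i u : i + r = size w -> exists2 t, t <= r * (T + size l' + 2) + 1 &
    exec (While j (Seq p (moves l'))) (slides l' (Posz i) (emit s k u))
      (slides l' (Posz (size w)) (emit s k (u ++ flatten (map h (iota i r))))) t.
  elim: r i u => [|r IH] i u size_w.
    rewrite addn0 in size_w; exists 1; rewrite // size_w cats0; apply: ExecWhileEnd.
    by rewrite readings_slides_head ?emit_other ?sj //= onth_default.
  have lt_i : i < size w by lia.
  have [t1 le1 run_p] := emits_p i lt_i u; rewrite !emit_slides in run_p.
  have [|t2 le2 run_loop] := IH i.+1 (u ++ h i); first lia.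
  exists ((t1 + (size l').+1 + t2).+1); first by rewrite mulSn; lia.
  apply: ExecWhileStep.
  - by rewrite readings_slides_head ?emit_other ?sj //= onthTE.
  - by apply: ExecSeq run_p _; exact: exec_moves.
  - by rewrite -slidesD -PoszD addn1 /= catA; exact: run_loop.
have [|t le run_loop] := loop (size w) 0 v; first by rewrite add0n.
exists (t + rewind_cost (size l') (size w)); first by rewrite leq_add2r.
rewrite -{1}(slides0 l' (emit s k v)); apply: ExecSeq run_loop _.
by apply: exec_rewind; rewrite ?emit_other.
Qed.

Inductive loop :=
| Print of ((I -> option B) -> B)
| Pass
| Then of loop & loop
| For of I & seq (I * bool) & loop.

Local Infix ";;" := Then (at level 60, right associativity).

Fixpoint compile k (g : loop) : prog I B :=
  match g with
  | Print f => Append k f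
  | Pass => Skip
  | g ;; h => Seq (compile k g) (compile k h)
  | For j l g => foreach j l (compile k g)
  end.

Fixpoint output (g : loop) s : seq B :=
  match g with
  | Print f => [:: f (readings s)]
  | Pass => [::]
  | g ;; h => output g s ++ output h s
  | For j l g => flatten (mkseq (fun i => output g (slides ((j, true) :: l) (Posz i) s))
                                (size (s j).1))
  end.

(* A loop moves neither the head of the printing tape [k] nor those in [moved], which
   are moved by the surrounding loops, except as companions of its own tape. *)
Fixpoint well_nested k (moved : seq I) (g : loop) : bool :=
  match g with
  | Print _ | Pass => true
  | g ;; h => well_nested k moved g && well_nested k moved h
  | For j l g => [&& j != k, j \notin moved, j \notin unzip1 l, k \notin unzip1 l
                   & well_nested k (j :: unzip1 l ++ moved) g]
  end.

Fixpoint cost (g : loop) (N : nat) : nat :=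
  match g with
  | Print _ | Pass => 1
  | g ;; h => cost g N + cost h N
  | For j l g => foreach_cost (size l).+1 N (cost g N)
  end.

Lemma foreach_cost_mono d n N T : n <= N -> foreach_cost d n T <= foreach_cost d N T.
Proof.
by move=> le; rewrite /foreach_cost /rewind_cost !(leq_add, leq_mul).
Qed.

Lemma size_output g s N : (forall i, size (s i).1 <= N) -> size (output g s) <= cost g N.
Proof.
elim: g s => [f||g IHg h IHh|j l g IH] s le //=.
  by rewrite size_cat leq_add ?IHg ?IHh.
apply: leq_trans (foreach_cost_mono _ _ (le j)); apply: (@leq_trans (size (s j).1 * cost g N)).
  rewrite /mkseq; elim: (size _) 0 => //= n IHn i.
  by rewrite size_cat mulSn leq_add // IH.
by rewrite /foreach_cost; lia.
Qed.

Lemma emits_compile k moved g s N : well_nested k moved g -> at_end s k ->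
  (forall i, size (s i).1 <= N) -> (forall i, i != k -> i \notin moved -> (s i).2 = 0%R) ->
  emits (compile k g) s k (output g s) (cost g N).
Proof.
elim: g moved s => [f||g IHg h IHh|j l g IH] moved s /=.
- move=> _ end_k _ _ v; exists 1 => //; rewrite emit_cat -(readings_emit v end_k).
  by apply: ExecAppend; exact: at_end_emit.
- by move=> _ _ _ _ v; exists 1; rewrite // cats0; exact: ExecSkip.
- move=> /andP[wn_g wn_h] end_k le home.
  by apply: emits_seq; [apply: IHg home | apply: IHh home].
move=> /and5P[jk j_fixed jl kl wn_g] end_k le home.
have k_kept z : slides ((j, true) :: l) z s k = s k.
  by rewrite slides_other // inE negb_or eq_sym jk.
move=> v; have [|i _|t le_t run] := @emits_foreach j l (compile k g) s k (s j).1
  (fun i => output g (slides ((j, true) :: l) (Posz i) s)) (cost g N) _ jk jl _ v.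
- by rewrite -(home j jk j_fixed); case: (s j).
- apply: (IH (j :: unzip1 l ++ moved)) => // [|i' i'k].
    by rewrite /at_end k_kept.
  rewrite inE mem_cat !negb_or => /and3P[i'j i'l i'_fixed].
  by rewrite slides_other ?home // inE negb_or i'j.
by exists t => //; apply: leq_trans le_t _; exact: foreach_cost_mono.
Qed.

Lemma poly_bounded_cost g f : poly_bounded f -> poly_bounded (fun n => cost g (f n)).
Proof.
move=> poly_f; elim: g => [h||g IHg h IHh|j l g IH] /=; try exact: poly_bounded_const.
  exact: poly_boundedD.
rewrite /foreach_cost /rewind_cost.
by poly_bounds.
Qed.

Lemma output_then g h s : output (g ;; h) s = output g s ++ output h s.
Proof. by []. Qed.

Lemma well_nested_then k moved g h :
  well_nested k moved (g ;; h) = well_nested k moved g && well_nested k moved h.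
Proof. by []. Qed.

Definition thens : seq loop -> loop := foldr Then Pass.

Lemma output_thens gs s : output (thens gs) s = flatten [seq output g s | g <- gs].
Proof. by elim: gs => //= g gs ->. Qed.

Lemma well_nested_thens k moved gs :
  well_nested k moved (thens gs) = all (well_nested k moved) gs.
Proof. by elim: gs => //= g gs ->. Qed.

Definition prints (w : seq B) : loop := thens [seq Print (fun=> b) | b <- w].

Lemma output_prints w s : output (prints w) s = w.
Proof. by rewrite output_thens -map_comp; elim: w => //= b w ->. Qed.

Lemma well_nested_prints k moved w : well_nested k moved (prints w).
Proof. by rewrite well_nested_thens all_map; elim: w. Qed.

Lemma output_for j l g s (F : B -> seq B) :
  (forall i b, onth (s j).1 i = Some b ->
     output g (slides ((j, true) :: l) (Posz i) s) = F b) ->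
  output (For j l g) s = flatten [seq F b | b <- (s j).1].
Proof. exact: flatten_mkseq_onth. Qed.

Lemma output_for_prints j l w s :
  output (For j l (prints w)) s = flatten (nseq (size (s j).1) w).
Proof.
rewrite (@output_for _ _ _ _ (fun=> w)) => [|i b _]; last exact: output_prints.
by rewrite map_const_nseq.
Qed.

End Loops.

Arguments rewind {I B}.
Arguments Print {I B}.
Infix ";;" := Then (at level 60, right associativity).
Arguments prints {I B} : simpl never.
Arguments output : simpl never.
Arguments Pass {I B}.

(** * Scripts: tapes filled one after the other *)

Section Scripts.
Variables (I : eqType) (B : Type).

Definition script := seq (I * loop I B).

Definition at_start (m : I -> seq B) : tapes I B := fun i => (m i, 0%R).

Definition fill (k : I) (g : loop I B) : prog I B := Seq (compile k g) (rewind k [:: (k, true)]).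

Definition script_prog (sc : script) : prog I B :=
  foldr (fun kg p => Seq (fill kg.1 kg.2) p) Skip sc.

Definition fill_cost (g : loop I B) (N : nat) : nat := cost g N + rewind_cost 1 (cost g N).

Fixpoint script_cost (sc : script) (N : nat) : nat :=
  if sc is kg :: sc' then fill_cost kg.2 N + script_cost sc' (N + cost kg.2 N) else 1.

(* Started with the words [c i] on the tapes [i] of [filled] and the other tapes blank,
   the script [sc] writes the words [c k] on its target tapes [k]. *)
Fixpoint computes (c : I -> seq B) (filled : seq I) (sc : script) : Prop :=
  if sc is (k, g) :: sc' then
    [/\ k \notin filled, well_nested k [::] g,
        forall m, {in filled, m =1 c} -> output g (at_start m) = c k
      & computes c (rcons filled k) sc']
  else True.

Lemma exec_fill k g m N : m k = [::] -> well_nested k [::] g -> (forall i, size (m i) <= N) ->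
  let m' i := if i == k then output g (at_start m) else m i in
  exists2 t, t <= fill_cost g N & exec (fill k g) (at_start m) (at_start m') t.
Proof.
move=> mk wn le m'; set u := output g _ in m' *.
have [||//|t le_t] := @emits_compile _ _ k [::] g (at_start m) N wn _ _ _ [::].
- by rewrite /at_end /= mk.
- exact: le.
rewrite emit0 -/u => run.
exists (t + rewind_cost 1 (size u)).
  by rewrite leq_add // /rewind_cost !leq_add2r leq_mul // size_output.
apply: ExecSeq run _.
rewrite (_ : emit _ _ _ = slides [:: (k, true)] (Posz (size u)) (at_start m')); last first.
  apply: functional_extensionality => i; rewrite /emit /update /slides /at_start /m' /=.
  case: eqP => _; first by rewrite mk GRing.addr0 GRing.mulr1.
  by rewrite GRing.mulr0 GRing.addr0.
by apply: exec_rewind; rewrite // /at_start /m' eqxx.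
Qed.

Lemma exec_script c filled sc m N : computes c filled sc -> {in filled, m =1 c} ->
  (forall i, i \notin filled -> m i = [::]) -> (forall i, size (m i) <= N) ->
  exists m' t, [/\ exec (script_prog sc) (at_start m) (at_start m') t,
    t <= script_cost sc N & {in filled ++ unzip1 sc, m' =1 c}].
Proof.
elim: sc filled m N => [|[k g] sc IH] filled m N /=.
  by move=> _ m_c _ _; exists m, 1; split; [exact: ExecSkip | | rewrite cats0].
move=> [k_new wn g_k sc_c] m_c m_new le.
have [t1 le1 run1] := exec_fill (m_new _ k_new) wn le; rewrite (g_k _ m_c) in run1.
set m1 := fun i : I => _ in run1.
have [||i|m' [t2 [run2 le2 m'_c]]] := IH (rcons filled k) m1 (N + cost g N) sc_c.
- move=> i; rewrite mem_rcons inE /m1; case: eqP => [->|_] //=; exact: m_c.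
- by move=> i; rewrite mem_rcons inE negb_or /m1 => /andP[/negPf -> /m_new].
- rewrite /m1; case: eqP => _; last exact: leq_trans (le i) (leq_addr _ _).
  by rewrite -(g_k _ m_c); apply: leq_trans (leq_addl _ _); exact: size_output.
exists m', (t1 + t2); split; first exact: ExecSeq run1 run2.
  exact: leq_add.
by rewrite -cat_rcons.
Qed.

Lemma computes_cat c filled sc sc' : computes c filled sc ->
  computes c (filled ++ unzip1 sc) sc' -> computes c filled (sc ++ sc').
Proof.
elim: sc filled => [|[k g] sc IH] filled /=; first by rewrite cats0.
by move=> [k_new wn g_k sc_c] sc'_c; split=> //; apply: IH; rewrite // cat_rcons.
Qed.

Lemma poly_bounded_script_cost sc f :
  poly_bounded f -> poly_bounded (fun n => script_cost sc (f n)).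
Proof.
elim: sc f => [|[k g] sc IH] f poly_f /=; first exact: poly_bounded_const.
have poly_g := poly_bounded_cost g poly_f.
apply: poly_boundedD; last by apply: IH; exact: poly_boundedD.
rewrite /fill_cost /rewind_cost.
by poly_bounds.
Qed.

Lemma computes_fills_cat c filled ks g sc : uniq ks -> ~~ has (mem filled) ks ->
  all (fun k => well_nested k [::] g) ks ->
  (forall m k, {in filled, m =1 c} -> k \in ks -> output g (at_start m) = c k) ->
  computes c (filled ++ ks) sc -> computes c filled ([seq (k, g) | k <- ks] ++ sc).
Proof.
elim: ks filled => [|k ks IH] filled /=; first by rewrite cats0.
case/andP=> k_ks ks_uniq; rewrite negb_or => /andP[k_new ks_new].
case/andP=> wn_k wn_ks g_ks sc_c; split=> // [w w_c|]; first by rewrite (g_ks w k) ?mem_head.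
apply: IH => // [|w k' w_c k'_ks|]; last by rewrite cat_rcons.
  apply/hasPn => k' k'_ks; rewrite /= mem_rcons inE negb_or (hasPn ks_new) // andbT.
  by apply: contraNneq k_ks => <-.
apply: g_ks; last by rewrite inE k'_ks orbT.
by move=> i i_filled; apply: w_c; rewrite mem_rcons inE i_filled orbT.
Qed.

Section Powers.
Variables (a : B) (src : I) (pw : nat -> I).

Definition powers (d : nat) : script :=
  (pw 0, prints [:: a]) ::
  [seq (pw i.+1, For (pw i) [::] (For src [::] (prints [:: a]))) | i <- iota 0 d].

Lemma unzip1_powers d : unzip1 (powers d) = mkseq pw d.+1.
Proof. by rewrite /mkseq /= (iotaDl 1) /unzip1 -!map_comp. Qed.

Lemma powersS d :
  powers d.+1 = rcons (powers d) (pw d.+1, For (pw d) [::] (For src [::] (prints [:: a]))).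
Proof. by rewrite /powers -{1}(addn1 d) iotaD map_cat -cats1. Qed.

Lemma computes_powers c filled d : src \in filled -> uniq (mkseq pw d.+1) ->
  ~~ has (mem filled) (mkseq pw d.+1) ->
  (forall i, i <= d -> c (pw i) = nseq (size (c src) ^ i) a) ->
  computes c filled (powers d).
Proof.
move=> src_filled; elim: d => [|d IH] pw_uniq pw_new c_pw.
  by split=> // [|m _]; [rewrite negb_or andbT in pw_new | rewrite c_pw].
move: pw_uniq pw_new; rewrite /mkseq -addn1 iotaD map_cat cats1 -/(mkseq pw d.+1).
rewrite rcons_uniq has_rcons negb_or => /andP[pwS_notin pw_uniq] /andP[pwS_new pw_new].
have pw_d : pw d \in mkseq pw d.+1 by apply: map_f; rewrite mem_iota leqnn.
rewrite powersS -cats1; apply: computes_cat; first by apply: IH => // i /leqW; exact: c_pw.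
have pw_src i : pw i \notin filled -> src != pw i by apply: contraNneq => <-.
split=> // [||m m_c].
- by rewrite unzip1_powers mem_cat negb_or pwS_new.
- rewrite /= !inE pw_src // pw_src ?(hasPn pw_new) // !andbT.
  by apply: contraNneq pwS_notin => <-.
have m_pw : m (pw d) = nseq (size (c src) ^ d) a.
  by rewrite m_c ?c_pw // unzip1_powers mem_cat pw_d orbT.
have m_src : m src = c src by rewrite m_c // mem_cat src_filled.
rewrite c_pw // expnSr (output_for (F := fun=> nseq (size (c src)) a)) => [|i b _].
  by rewrite /= m_pw map_nseq flatten_nseq.
rewrite output_for_prints slides_other /= ?m_src ?flatten_nseq1 //.
by rewrite inE pw_src // (hasPn pw_new).
Qed.

Definition unary_polynomial (m d : nat) : loop I B :=
  For (pw d) [::] (prints (nseq m a)) ;; prints (nseq m a).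

Lemma output_unary_polynomial m d n s : size (s (pw d)).1 = n ^ d ->
  output (unary_polynomial m d) s = nseq (m * n ^ d + m) a.
Proof.
move=> size_pw; rewrite output_then output_for_prints output_prints.
by rewrite size_pw flatten_nseq mulnC nseqD.
Qed.

End Powers.

End Scripts.

Lemma script_polynomial_time (I B : finType) (bit : bool -> B) (inp out : I)
    (sc : script I B) (c : seq bool -> I -> seq B) f :
  injective bit -> inp != out -> out \in unzip1 sc ->
  (forall x, c x inp = map bit x) -> (forall x, c x out = map bit (f x)) ->
  (forall x, computes (c x) [:: inp] sc) -> polynomial_time f.
Proof.
move=> bit_inj inp_out out_sc c_inp c_out sc_c.
apply: (prog_polynomial_time (out := out) (p := script_prog sc) bit_inj inp_out
  (poly_bounded_script_cost sc poly_bounded_id)) => x.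
pose m i := if i == inp then map bit x else [::].
have [||i|m' [t [run le m'_c]]] := @exec_script _ _ (c x) _ sc m (size x) (sc_c x).
- by move=> i; rewrite inE /m => /eqP ->; rewrite eqxx c_inp.
- by move=> i; rewrite inE /m => /negPf ->.
- by rewrite /m; case: eqP; rewrite ?size_map.
exists (at_start m'), t; split=> //=.
by rewrite m'_c ?c_out // inE out_sc orbT.
Qed.

(** * Temporal graphs given by lists of edges *)

Lemma set2_inj (T : finType) (a b c d : T) :
  [set a; b] = [set c; d] -> (a, b) = (c, d) \/ (a, b) = (d, c).
Proof.
move=> /setP E; have := E a; have := E b; have := E c; have := E d.
rewrite !inE !eqxx ?orbT /= => hd hc /esym hb /esym ha.
case/orP: ha => /eqP Ea; case/orP: hb => /eqP Eb; rewrite Ea Eb ?orbb in hc hd *; auto.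
  by left; rewrite (eqP hd).
by left; rewrite (eqP hc).
Qed.

Lemma card_bigcup_seq (I X : finType) (l : seq I) (A : I -> {set X}) d :
  (forall i, #|A i| <= d) -> #|\bigcup_(i <- l) A i| <= size l * d.
Proof.
move=> le; elim: l => [|i l IH]; first by rewrite big_nil cards0.
by rewrite big_cons (leq_trans (leq_card_setU _ _)) // mulSn leq_add.
Qed.

Lemma map_enum_val (T : finType) (X : Type) (F : T -> X) :
  [seq F (enum_val i) | i <- enum 'I_#|T|] = [seq F x | x <- enum T].
Proof.
rewrite (map_comp F enum_val); congr map.
case: (pickP T) => [x0 _|/eq_card0 T0]; last first.
  by rewrite [RHS]size0nil -?cardE // [LHS]size0nil // size_map size_enum_ord.
rewrite -[RHS](mkseq_nth x0) /mkseq -cardE -val_enum_ord -map_comp.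
by apply: eq_map => i; exact: enum_val_nth.
Qed.

Section EdgeLists.
Variables (V T : finType) (edges : T -> seq (V * V)).

Definition joined (t : T) (u v : V) : bool :=
  ((u, v) \in edges t) || ((v, u) \in edges t).

Hypothesis joined_irrefl : forall t v, ~~ joined t v v.
Hypothesis joined_once : forall t t' u v, joined t u v -> joined t' u v -> t = t'.

Definition vertex_pair (u v : V) : {set 'I_#|V|} := [set enum_rank u; enum_rank v].

Definition edge_list_snapshot (i : 'I_#|T|) : {set {set 'I_#|V|}} :=
  [set vertex_pair e.1 e.2 | e in edges (enum_val i)].

Lemma mem_edge_list_snapshot i u v :
  (vertex_pair u v \in edge_list_snapshot i) = joined (enum_val i) u v.
Proof.
apply/imsetP/orP => [[[u' v'] /= e /set2_inj]|[] e]; last 2 first.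
- by exists (u, v).
- by exists (v, u); rewrite // /vertex_pair setUC.
by move=> [] [/enum_rank_inj-> /enum_rank_inj->]; [left | right].
Qed.

Lemma edge_list_simple i e : e \in edge_list_snapshot i -> #|e| = 2.
Proof.
case/imsetP => -[u v] /= e_uv ->; rewrite cards2 (inj_eq enum_rank_inj).
suff -> : u != v by [].
by apply: contraNneq (joined_irrefl (enum_val i) u) => uv; rewrite /joined {2}uv e_uv.
Qed.

Definition edge_list_graph : temporal_graph 'I_#|V| #|T| := TemporalGraph edge_list_simple.

Lemma edge_list_snapshot_once i i' e :
  e \in edge_list_snapshot i -> e \in edge_list_snapshot i' -> i = i'.
Proof.
move=> /imsetP[[u v] /= e_uv ->]; rewrite mem_edge_list_snapshot => e'_uv.
by apply: enum_val_inj; apply: joined_once e'_uv; rewrite /joined e_uv.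
Qed.

Lemma edge_list_each_edge_once : each_edge_once edge_list_graph.
Proof.
move=> e /bigcupP[i _ e_i]; apply/eqP/cards1P; exists i; apply/setP => i'.
by rewrite !inE; apply/idP/eqP => [/edge_list_snapshot_once/(_ e_i)|->].
Qed.

Lemma edge_list_interval_membership i :
  interval_membership edge_list_graph i = edge_list_snapshot i.
Proof.
apply/setP => e; rewrite inE; apply/idP/idP => [/andP[_]|e_i].
  case/existsP => a /existsP[b /andP[/andP[le_ai le_ib] /setIP[e_a e_b]]].
  rewrite (_ : i = a) //; apply: val_inj; apply/eqP; rewrite eqn_leq le_ai.
  by rewrite (edge_list_snapshot_once e_a e_b) le_ib.
apply/andP; split; first by apply/bigcupP; exists i.
by apply/existsP; exists i; apply/existsP; exists i; rewrite leqnn inE e_i.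
Qed.

Section Bounds.
Variable d : nat.
Hypothesis size_edges : forall t, size (edges t) <= d.

Lemma card_edge_list_snapshot i : #|edge_list_snapshot i| <= d.
Proof.
by rewrite (leq_trans (leq_imset_card _ _)) // (leq_trans (card_size _)).
Qed.

Lemma edge_list_imw_le : imw edge_list_graph <= d.
Proof.
apply/bigmax_leqP => i _.
by rewrite edge_list_interval_membership card_edge_list_snapshot.
Qed.

Lemma edge_list_degree_le (occurrences : V -> seq T) D :
  (forall t u v, (u, v) \in edges t -> (t \in occurrences u) && (t \in occurrences v)) ->
  (forall v, size (occurrences v) <= D) ->
  forall v, underlying_degree edge_list_graph v <= D * d.
Proof.
move=> occur size_occ v; set occ := occurrences (enum_val v).
apply: (@leq_trans #|\bigcup_(t <- occ) edge_list_snapshot (enum_rank t)|); last first.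
  apply: leq_trans (leq_mul (size_occ (enum_val v)) (leqnn d)).
  by apply: card_bigcup_seq => t; exact: card_edge_list_snapshot.
apply/subset_leq_card/subsetP => e; rewrite inE => /andP[/bigcupP[i _ e_i] v_e].
rewrite bigcup_seq; apply/bigcupP; exists (enum_val i); last by rewrite enum_valK.
case/imsetP: e_i v_e => -[a b] /= /occur/andP[occ_a occ_b] ->.
by rewrite /occ !inE => /orP[] /eqP ->; rewrite enum_rankK.
Qed.

End Bounds.

Lemma edge_list_imw_ge t x s :
  uniq s -> {in s, forall y, joined t x y} -> size s <= imw edge_list_graph.
Proof.
move=> s_uniq star; apply: leq_trans (leq_bigmax (enum_rank t)).
rewrite edge_list_interval_membership -(card_uniqP s_uniq).
have pair_inj : {in s &, injective (vertex_pair x)}.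
  move=> y y' sy _ /set2_inj[[/enum_rank_inj]//|[_ /enum_rank_inj yx]].
  by have := star y sy; rewrite yx (negPf (joined_irrefl t x)).
rewrite -(card_in_imset pair_inj); apply/subset_leq_card/subsetP => _ /imsetP[y sy ->].
by rewrite mem_edge_list_snapshot enum_rankK star.
Qed.

Variables (k : nat) (k_gt0 : 0 < k).

Definition edge_list_instance : tvc_instance := @TVCInstance _ _ edge_list_graph k 0 k_gt0.

Definition activity_cover (act : V -> T -> bool) : Prop :=
  (forall v, #|act v| <= k) /\
  (forall t u v, (u, v) \in edges t -> act u t || act v t).

Lemma cover_of_timeline S : is_timeline k 0 S -> covers_all edge_list_graph S ->
  activity_cover (fun v t => (enum_rank v, enum_rank t, enum_rank t) \in S).
Proof.
move=> [S_ordered S_short S_few] S_covers; split=> [v|t u v e_uv].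
  pose interval t : 'I_#|V| * 'I_#|T| * 'I_#|T| := (enum_rank v, enum_rank t, enum_rank t).
  have interval_inj : injective interval by move=> t t' [/enum_rank_inj].
  apply: leq_trans (S_few (enum_rank v)); rewrite -[X in X <= _](card_imset _ interval_inj).
  by apply/subset_leq_card/subsetP => _ /imsetP[t act_t ->]; rewrite inE eqxx andbT.
have [] := S_covers (enum_rank t) (vertex_pair u v).
  by rewrite [_ \in _]mem_edge_list_snapshot enum_rankK /joined e_uv.
move=> w w_uv [a [b [S_ab /andP[le_a le_b]]]].
have le_ba : b <= a by rewrite -subn_eq0 -leqn0; exact: S_short S_ab.
have a_t : a = enum_rank t by apply/val_inj/eqP; rewrite eqn_leq le_a (leq_trans le_b).
have b_t : b = enum_rank t by apply/val_inj/eqP; rewrite eqn_leq le_b (leq_trans le_ba).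
rewrite a_t b_t in S_ab.
by move: w_uv; rewrite !inE => /orP[] /eqP <-; rewrite S_ab ?orbT.
Qed.

Lemma timeline_of_cover act : activity_cover act ->
  let S := [set x : 'I_#|V| * 'I_#|T| * 'I_#|T| |
             (x.1.2 == x.2) && act (enum_val x.1.1) (enum_val x.2)] in
  is_timeline k 0 S /\ covers_all edge_list_graph S.
Proof.
move=> [act_few act_covers] S; split; last first.
  move=> i e /imsetP[[u v] /= /act_covers act_uv ->].
  by case/orP: act_uv => act_w; [exists (enum_rank u)|exists (enum_rank v)];
    rewrite ?inE ?eqxx ?orbT //; exists i, i; rewrite leqnn inE eqxx enum_rankK act_w.
split=> [v a b|v a b|v]; try by rewrite inE /= => /andP[/eqP -> _]; rewrite ?subnn.
apply: leq_trans (act_few (enum_val v)).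
apply: leq_trans (leq_imset_card (fun t => (v, enum_rank t, enum_rank t)) _).
apply/subset_leq_card/subsetP => -[[v' a] b]; rewrite !inE /=.
case/andP => /andP[/eqP -> act_b] /eqP <-; apply/imsetP.
by exists (enum_val b); rewrite ?enum_valK.
Qed.

Lemma edge_list_yes : tvc_yes edge_list_instance <-> exists act, activity_cover act.
Proof.
split=> [[S [S_timeline S_covers]]|[act act_cover]].
  by eexists; exact: cover_of_timeline S_timeline S_covers.
by eexists; exact: timeline_of_cover act_cover.
Qed.

Lemma edge_list_encode : tvc_encode edge_list_instance =
  unary #|V| ++ unary #|T| ++ delimit (binary k) ++ delimit (binary 0) ++
  flatten [seq flatten [seq [seq joined t u v | v <- enum V] | u <- enum V] | t <- enum T].
Proof.
rewrite /tvc_encode; do 4!congr cat; congr flatten.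
rewrite -[RHS]map_enum_val; apply: eq_map => i; congr flatten.
rewrite -[RHS]map_enum_val; apply: eq_map => u.
rewrite -[RHS]map_enum_val; apply: eq_map => v.
by rewrite -mem_edge_list_snapshot /vertex_pair !enum_valK.
Qed.

End EdgeLists.

(** * The gadget *)

(* The tile [i] is chosen in a cell when [Clause i] is inactive at time [Select i].
   The vertices [Relay b i k], for increasing [k], are then inactive at the times
   [Signal b i k]. [Conflict b i j] forbids the tile [j] in its own cell next to the
   tile [i] in the previous cell of direction [b]. *)
Inductive main_vertex (m : nat) :=
| Clause of 'I_m
| Relay of bool & 'I_m & 'I_m
| Conflict of bool & 'I_m & 'I_m.

Inductive vertex (m : nat) :=
| Main of main_vertex m
| Dead of main_vertex m & 'I_5
| Dummy of 'I_5.

Inductive time (m : nat) :=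
| Link of 'I_m
| Forced of main_vertex m
| Select of 'I_m
| Signal of bool & 'I_m & 'I_m
| Drain of main_vertex m & 'I_5 & bool
| Star.

Arguments Dummy {m}.
Arguments Star {m}.

Section Finiteness.
Variable m : nat.

Definition main_vertex_code (v : main_vertex m) :
    'I_m + (bool * 'I_m * 'I_m + bool * 'I_m * 'I_m) :=
  match v with
  | Clause i => inl i
  | Relay b i j => inr (inl (b, i, j))
  | Conflict b i j => inr (inr (b, i, j))
  end.

Definition main_vertex_decode x : main_vertex m :=
  match x with
  | inl i => Clause i
  | inr (inl (b, i, j)) => Relay b i j
  | inr (inr (b, i, j)) => Conflict b i j
  end.

Lemma main_vertex_codeK : cancel main_vertex_code main_vertex_decode.
Proof. by case. Qed.

HB.instance Definition _ := Finite.copy (main_vertex m) (can_type main_vertex_codeK).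

Definition vertex_code (v : vertex m) : main_vertex m + (main_vertex m * 'I_5 + 'I_5) :=
  match v with
  | Main v => inl v
  | Dead v i => inr (inl (v, i))
  | Dummy i => inr (inr i)
  end.

Definition vertex_decode x : vertex m :=
  match x with
  | inl v => Main v
  | inr (inl (v, i)) => Dead v i
  | inr (inr i) => Dummy i
  end.

Lemma vertex_codeK : cancel vertex_code vertex_decode.
Proof. by case. Qed.

HB.instance Definition _ := Finite.copy (vertex m) (can_type vertex_codeK).

Definition time_code (t : time m) :
    'I_m + (main_vertex m + ('I_m + (bool * 'I_m * 'I_m
      + (main_vertex m * 'I_5 * bool + unit)))) :=
  match t with
  | Link i => inl i
  | Forced v => inr (inl v)
  | Select i => inr (inr (inl i))
  | Signal b i j => inr (inr (inr (inl (b, i, j))))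
  | Drain v i b => inr (inr (inr (inr (inl (v, i, b)))))
  | Star => inr (inr (inr (inr (inr tt))))
  end.

Definition time_decode x : time m :=
  match x with
  | inl i => Link i
  | inr (inl v) => Forced v
  | inr (inr (inl i)) => Select i
  | inr (inr (inr (inl (b, i, j)))) => Signal b i j
  | inr (inr (inr (inr (inl (v, i, b))))) => Drain v i b
  | inr (inr (inr (inr (inr tt)))) => Star
  end.

Lemma time_codeK : cancel time_code time_decode.
Proof. by case. Qed.

HB.instance Definition _ := Finite.copy (time m) (can_type time_codeK).

End Finiteness.

Section OrdinalChain.
Variable m : nat.
Implicit Types i j : 'I_m.

Definition onext i : option 'I_m := insub i.+1.

Definition opred i : 'I_m := Ordinal (leq_ltn_trans (leq_pred i) (ltn_ord i)).

Definition ofirst i : 'I_m := Ordinal (leq_ltn_trans (leq0n i) (ltn_ord i)).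

Lemma onextP i j : onext i = Some j -> j = i.+1 :> nat.
Proof. by rewrite /onext; case: insubP => // k _ <- [->]. Qed.

Lemma onext_val i j : j = i.+1 :> nat -> onext i = Some j.
Proof.
move=> ij; rewrite /onext; case: insubP => [j' _ ij'|]; last by rewrite -ij ltn_ord.
by congr Some; apply: val_inj; rewrite /= ij'.
Qed.

Lemma onext_None i : onext i = None -> i.+1 = m.
Proof. by rewrite /onext; case: insubP => // H _; have := ltn_ord i; lia. Qed.

Lemma onext_opred i j : onext i = Some j -> opred j = i.
Proof. by move/onextP => E; apply: val_inj; rewrite /= E. Qed.

Lemma chain_ind (Q : 'I_m -> Prop) :
  (forall i, i = 0 :> nat -> Q i) -> (forall i j, onext i = Some j -> Q i -> Q j) ->
  forall i, Q i.
Proof.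
move=> Q0 QS [i lti]; elim: i lti => [|i IH] lti; first exact: Q0.
by apply: QS (IH (ltnW lti)); rewrite /onext insubT.
Qed.

End OrdinalChain.

Section LocalEdges.
Variables (m : nat) (conflict : bool -> rel 'I_m).
Implicit Types (i j k : 'I_m) (u v : vertex m) (w : main_vertex m) (t : time m).

Definition drain_head (i : 'I_5) (b : bool) : 'I_5 := (i + (if b then 1 else 2))%R.

Definition drain_tail (i : 'I_5) (b : bool) : 'I_5 := (i - (if b then 1 else 2))%R.

Lemma drain_headK b : cancel (drain_head^~ b) (drain_tail^~ b).
Proof. by move=> i; exact: GRing.addrK. Qed.

Definition is_forced w : bool := if w is Clause i then i == 0 :> nat else true.

(* An edge [(u, (r, v))] joins [u] in the cell owning the snapshot to [v] in the
   same cell ([r = None]) or in the next cell of direction [b] ([r = Some b]). *)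
Definition local_edges (forbidden : pred 'I_m) t :
    seq (vertex m * (option bool * vertex m)) :=
  match t with
  | Link i => [:: (Main (Clause i), (None,
        if onext i is Some j then Main (Clause j) else Dead (Clause i) 1%R))]
  | Forced w => nseq (is_forced w) (Main w, (None, Dead w 0%R))
  | Select i =>
      [:: (Main (Clause i), (None, Main (Relay false i (ofirst i))));
          (Main (Clause i), (None, Main (Relay true i (ofirst i))))] ++
      nseq (forbidden i) (Main (Clause i), (None, Dead (Clause i) 2%R))
  | Signal b i k =>
      (if onext k is Some k'
       then [:: (Main (Relay b i k), (None, Main (Relay b i k')))] else [::]) ++
      nseq (conflict b i k) (Main (Relay b i k), (Some b, Main (Conflict b i k))) ++
      nseq (conflict b k i) (Main (Relay b i k), (None, Main (Conflict b k i)))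
  | Drain w i b => [:: (Dead w i, (None, Dead w (drain_head i b)))]
  | Star => [seq (Dummy 0%R, (None, Dummy x)) | x <- [:: 1; 2; 3; 4]%R]
  end.

Definition edge_time u v : option (time m) :=
  match u, v with
  | Main (Clause i), Main (Clause j) => if j == i.+1 :> nat then Some (Link i) else None
  | Main (Clause i), Main (Relay _ _ _) => Some (Select i)
  | Main (Relay b i k), Main (Relay _ _ k') =>
      if k' == k.+1 :> nat then Some (Signal b i k) else None
  | Main (Relay b i k), Main (Conflict _ _ _) => Some (Signal b i k)
  | Main w, Dead _ j =>
      match w with
      | Clause i => if j == 0 :> nat then Some (Forced w)
                    else if j == 1 :> nat then Some (Link i) else Some (Select i)
      | _ => Some (Forced w)
      end
  | Dead w i, Dead _ j =>
      if j == drain_head i true then Some (Drain w i true)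
      else if j == drain_head i false then Some (Drain w i false) else None
  | Dummy i, Dummy j => if i == 0 :> nat then Some Star else None
  | _, _ => None
  end.

Lemma local_edge_time F t u r v : (u, (r, v)) \in local_edges F t ->
  edge_time u v = Some t /\ edge_time v u = None.
Proof.
case: t => [i|w|i|b i k|w i b|] /=.
- rewrite inE; case E: (onext i) => [j|] /eqP[-> _ ->] //=.
  by rewrite (onextP E) eqxx; split => //; rewrite ifN //; lia.
- by move=> /nseqP[[-> _ ->]]; case: w => [i|b i j|b i j] //=.
- by rewrite !inE => /or3P[/eqP[-> _ ->]|/eqP[-> _ ->]|/nseqP[[-> _ ->]]].
- rewrite !mem_cat => /or3P[|/nseqP[[-> _ ->]]|/nseqP[[-> _ ->]]] //.
  case E: (onext k) => [j|] //; rewrite inE => /eqP[-> _ ->] /=.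
  by rewrite (onextP E) eqxx; split => //; rewrite ifN //; lia.
- rewrite inE => /eqP[-> _ ->] /=.
  by case: b; case: i => [[|[|[|[|[|]]]]] //=].
- by rewrite !inE => /or4P[] /eqP[-> _ ->].
Qed.

Lemma size_local_edges F t : size (local_edges F t) <= 4.
Proof.
case: t => [i|w|i|b i k|w i b|] //=; first by rewrite size_nseq; case: is_forced.
  by rewrite size_nseq; case: (F i).
by rewrite !size_cat !size_nseq; case: (onext k) => [?|]; case: conflict; case: conflict.
Qed.

End LocalEdges.

Section Gadget.
Variables (m : nat) (conflict : bool -> rel 'I_m).
Variables (P : finType) (next : bool -> P -> option P) (forbidden : P -> pred 'I_m).
Implicit Types (b : bool) (p q : P) (i j k : 'I_m) (w : main_vertex m).

Definition is_tiling (tau : P -> 'I_m) : Prop :=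
  (forall p, ~~ forbidden p (tau p)) /\
  forall b p q, next b p = Some q -> ~~ conflict b (tau p) (tau q).

Hypothesis next_neq : forall b p, next b p != Some p.
Hypothesis next_inj : forall b p p' q, next b p = Some q -> next b p' = Some q -> p = p'.

Local Notation gvertex := (P * vertex m)%type.
Local Notation gtime := (P * time m)%type.

Definition cell_at (r : option bool) p : option P := if r is Some b then next b p else Some p.

Definition gadget_edges (t : gtime) : seq (gvertex * gvertex) :=
  pmap (fun e => omap (fun q => ((t.1, e.1), (q, e.2.2))) (cell_at e.2.1 t.1))
       (local_edges conflict (forbidden t.1) t.2).

Lemma gadget_edgesP (t : gtime) (u v : gvertex) : reflect
  (exists r, [/\ u.1 = t.1, cell_at r t.1 = Some v.1
     & (u.2, (r, v.2)) \in local_edges conflict (forbidden t.1) t.2])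
  ((u, v) \in gadget_edges t).
Proof.
rewrite mem_pmap; apply: (iffP mapP) => [[[x [r y]] /= e]|[r [E r_v e]]].
  by case r_q: (cell_at r t.1) => [q|] //= [-> ->]; exists r.
case: u v E r_v e => [p u] [q v] /= -> r_v e.
by exists (u, (r, v)); rewrite //= r_v.
Qed.

Lemma size_gadget_edges t : size (gadget_edges t) <= 4.
Proof.
by rewrite size_pmap (leq_trans (count_size _ _)) // size_local_edges.
Qed.

Lemma gadget_joined_irrefl t v : ~~ joined gadget_edges t v v.
Proof.
by rewrite /joined orbb; apply/negP => /gadget_edgesP[r [_ _ /local_edge_time[->]]].
Qed.

Lemma gadget_joined_once t t' u v :
  joined gadget_edges t u v -> joined gadget_edges t' u v -> t = t'.
Proof.
wlog uv_t : u v / (u, v) \in gadget_edges t.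
  move=> sym /orP[uv_t|vu_t]; first by apply: sym => //; rewrite /joined uv_t.
  by rewrite /joined orbC; apply: sym => //; rewrite /joined vu_t.
move=> _; case/gadget_edgesP: uv_t => r [ut _ /local_edge_time[uv_t vu_t]].
case/orP => /gadget_edgesP[r' [ut' _ /local_edge_time[uv_t' vu_t']]].
  rewrite [t]surjective_pairing [t']surjective_pairing -ut -ut'; congr pair.
  by apply: Some_inj; rewrite -uv_t.
by rewrite vu_t' in uv_t.
Qed.

Section Soundness.
Variable act : gvertex -> gtime -> bool.
Hypothesis act_cover : activity_cover gadget_edges 2 act.

Lemma sum_act_le v ts : uniq ts -> \sum_(t <- ts) act v t <= 2.
Proof.
move=> ts_uniq; have [/(_ v) few _] := act_cover; apply: leq_trans few.
have -> : \sum_(t <- ts) act v t = count (act v) ts.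
  by rewrite -sum1_count [RHS]big_mkcond; apply: eq_bigr => t _; case: act.
rewrite -size_filter -(card_uniqP (filter_uniq _ ts_uniq)).
by apply/subset_leq_card/subsetP => t; rewrite mem_filter => /andP[].
Qed.

Lemma third_time_inactive v t1 t2 t3 : t1 <> t2 -> t1 <> t3 -> t2 <> t3 ->
  act v t1 -> act v t2 -> act v t3 = false.
Proof.
move=> /eqP ne12 /eqP ne13 /eqP ne23 act1 act2.
have := @sum_act_le v [:: t1; t2; t3]; rewrite /= !inE negb_or ne12 ne13 ne23.
by rewrite !big_cons big_nil act1 act2; case: act => // /(_ isT).
Qed.

Lemma act_local p t u v : (u, (None, v)) \in local_edges conflict (forbidden p) t ->
  act (p, u) (p, t) || act (p, v) (p, t).
Proof.
by move=> e; have [_] := act_cover; apply; apply/gadget_edgesP; exists None.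
Qed.

(* The ten edges between the five vertices use up their total capacity. *)
Lemma dead_inactive p w x t : (forall y b, t <> (p, Drain w y b)) ->
  act (p, Dead w x) t = false.
Proof.
move=> not_drain; pose a y t' : nat := act (p, Dead w y) t'.
pose T (yb : 'I_5 * bool) : gtime := (p, Drain w yb.1 yb.2).
have edge y b : 1 <= a y (T (y, b)) + a (drain_head y b) (T (y, b)).
  have := @act_local p (Drain w y b) _ _ (mem_head _ _); rewrite /a /T /=.
  by do 2!case: act.
have capacity y : a y t + (a y (T (y, true)) + (a y (T (y, false))
    + (a y (T (drain_tail y true, true)) + a y (T (drain_tail y false, false))))) <= 2.
  have := @sum_act_le (p, Dead w y) (t :: [seq T z | z <-
    [:: (y, true); (y, false); (drain_tail y true, true); (drain_tail y false, false)]]).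
  rewrite !big_cons big_nil addn0; apply.
  rewrite cons_uniq map_inj_uniq => [|[z b] [z' b'] [-> ->] //].
  apply/andP; split; last by case: y => [[|[|[|[|[|]]]]]].
  by apply/mapP => -[[z b] _]; exact: not_drain.
pose tails b := \sum_(y < 5) a y (T (drain_tail y b, b)).
pose heads b := \sum_(y < 5) a y (T (y, b)).
have all_edges b : 5 <= heads b + tails b.
  rewrite /tails (reindex_inj (can_inj (drain_headK b))) -big_split.
  rewrite -[X in X <= _]card_ord -sum1_card; apply: leq_sum => y _.
  by rewrite drain_headK edge.
have total : \sum_(y < 5) a y t + (heads true + (heads false + (tails true + tails false))) <= 10.
  by rewrite -!big_split -[10]/(5 * 2) -[X in X * 2]card_ord -sum_nat_const leq_sum.
have := all_edges true; have := all_edges false => cover0 cover1.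
have/eqP : \sum_(y < 5) a y t = 0 by lia.
by rewrite sum_nat_eq0 => /forallP/(_ x); rewrite /a; case: act.
Qed.

Lemma forced_active p w : is_forced w -> act (p, Main w) (p, Forced w).
Proof.
move=> forced; have := @act_local p (Forced w) (Main w) (Dead w 0%R).
by rewrite dead_inactive // orbF; apply; rewrite /= forced mem_head.
Qed.

Lemma relay_inactive p b i k : ~~ act (p, Main (Clause i)) (p, Select i) ->
  act (p, Main (Relay b i k)) (p, Signal b i k) = false.
Proof.
move=> /negPf selected; elim/chain_ind: k => [k k0|k k' kk' IH].
  apply: (@third_time_inactive _ (p, Select i) (p, Forced (Relay b i k))) => //.
    have := @act_local p (Select i) (Main (Clause i)) (Main (Relay b i k)).
    rewrite selected; apply; rewrite (_ : k = ofirst i); last exact: val_inj.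
    by case: b; rewrite !inE eqxx ?orbT.
  exact: forced_active.
apply: (@third_time_inactive _ (p, Signal b i k) (p, Forced (Relay b i k'))) => //.
- by move=> -[] E; have := onextP kk'; rewrite E; lia.
- have := @act_local p (Signal b i k) (Main (Relay b i k)) (Main (Relay b i k')).
  by rewrite IH; apply; rewrite /= kk' mem_head.
- exact: forced_active.
Qed.

Lemma some_selected p : 0 < m -> exists i, ~~ act (p, Main (Clause i)) (p, Select i).
Proof.
move=> m_gt0; apply/existsP/contraT; rewrite negb_exists => /forallP none_selected.
have {none_selected} selects i : act (p, Main (Clause i)) (p, Select i).
  by have := none_selected i; rewrite negbK.
have link_inactive i : act (p, Main (Clause i)) (p, Link i) = false.
  elim/chain_ind: i => [i i0|i j ij IH].
    apply: (@third_time_inactive _ (p, Select i) (p, Forced (Clause i))) => //.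
    by apply: forced_active; apply/eqP.
  apply: (@third_time_inactive _ (p, Select j) (p, Link i)) => //.
    by move=> -[] E; have := onextP ij; rewrite E; lia.
  have := @act_local p (Link i) (Main (Clause i)) (Main (Clause j)).
  by rewrite IH; apply; rewrite /= ij mem_head.
have lt_m : m.-1 < m by rewrite prednK.
pose i := Ordinal lt_m.
have last_i : onext i = None by rewrite /onext insubN //= prednK // ltnn.
have := @act_local p (Link i) (Main (Clause i)) (Dead (Clause i) 1%R).
by rewrite link_inactive dead_inactive //; apply; rewrite /= last_i mem_head.
Qed.

Lemma not_forbidden p i :
  ~~ act (p, Main (Clause i)) (p, Select i) -> ~~ forbidden p i.
Proof.
move=> /negPf selected; apply/negP => bad_i; suff: false by [].
have := @act_local p (Select i) (Main (Clause i)) (Dead (Clause i) 2%R).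
by rewrite selected dead_inactive //; apply; rewrite /= bad_i !inE eqxx !orbT.
Qed.

Lemma not_conflict b p q i j : next b p = Some q ->
  ~~ act (p, Main (Clause i)) (p, Select i) -> ~~ act (q, Main (Clause j)) (q, Select j) ->
  ~~ conflict b i j.
Proof.
move=> pq sel_i sel_j; apply/negP => bad_ij; pose v : gvertex := (q, Main (Conflict b i j)).
have act_p : act v (p, Signal b i j).
  have [_ /(_ (p, Signal b i j) (p, Main (Relay b i j)) v)] := act_cover.
  rewrite relay_inactive //; apply; apply/gadget_edgesP; exists (Some b).
  by rewrite /= bad_ij !mem_cat mem_head orbT.
have act_q : act v (q, Signal b j i).
  have := @act_local q (Signal b j i) (Main (Relay b j i)) (Main (Conflict b i j)).
  by rewrite relay_inactive //; apply; rewrite /= bad_ij !mem_cat mem_head !orbT.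
have := @forced_active q (Conflict b i j) isT.
rewrite (third_time_inactive _ _ _ act_p act_q) // => -[E _ _].
by move: pq; rewrite E; apply/eqP/next_neq.
Qed.

Lemma tiling_of_cover : 0 < m -> exists tau, is_tiling tau.
Proof.
move=> m_gt0; have chosen p := xchooseP (some_selected p m_gt0).
exists (fun p => xchoose (some_selected p m_gt0)); split=> [p|b p q pq].
  exact: not_forbidden (chosen p).
exact: not_conflict pq (chosen p) (chosen q).
Qed.

End Soundness.
Section Completeness.
Variable tau : P -> 'I_m.
Hypothesis tau_tiling : is_tiling tau.

Definition previous b q : option P := [pick p | next b p == Some q].

Lemma nextK b p q : next b p = Some q -> previous b q = Some p.
Proof.
move=> pq; rewrite /previous; case: pickP => [p' /eqP p'q|/(_ p)]; last by rewrite pq eqxx.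
by congr Some; exact: next_inj p'q pq.
Qed.

Definition link_in i : time m := if i == 0 :> nat then Forced (Clause i) else Link (opred i).

Definition relay_in b i k : time m := if k == 0 :> nat then Select i else Signal b i (opred k).

Definition schedule (v : gvertex) : seq gtime :=
  let: (p, v) := v in
  match v with
  | Main (Clause i) =>
      if i < tau p then [:: (p, link_in i); (p, Select i)]
      else if i == tau p then [:: (p, link_in i); (p, Link i)]
      else [:: (p, Link i); (p, Select i)]
  | Main (Relay b i k) =>
      [:: (p, Forced (Relay b i k));
          (p, if i == tau p then relay_in b i k else Signal b i k)]
  | Main (Conflict b i j) =>
      [:: (p, Forced (Conflict b i j));
          if j == tau p then (p, Signal b j i) else (odflt p (previous b p), Signal b i j)]
  | Dead w i => [:: (p, Drain w i true); (p, Drain w i false)]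
  | Dummy _ => [:: (p, Star)]
  end.

Lemma size_schedule v : size (schedule v) <= 2.
Proof. by case: v => p [[i|b i k|b i j]|w i|i] //=; case: ltngtP => //; case: eqP. Qed.

Lemma schedule_link_in p i : i <= tau p -> (p, link_in i) \in schedule (p, Main (Clause i)).
Proof. by rewrite /=; case: ltngtP => // [|/val_inj ->]; rewrite ?eqxx inE eqxx. Qed.

Lemma schedule_link p i : tau p <= i -> (p, Link i) \in schedule (p, Main (Clause i)).
Proof.
by rewrite /= leqNgt => /negPf ->; case: (i == tau p); rewrite !inE eqxx ?orbT.
Qed.

Lemma schedule_select p i : i != tau p -> (p, Select i) \in schedule (p, Main (Clause i)).
Proof. by move=> /negPf /= ->; case: ifP; rewrite !inE eqxx orbT. Qed.

Lemma schedule_relay_in p b k :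
  (p, relay_in b (tau p) k) \in schedule (p, Main (Relay b (tau p) k)).
Proof. by rewrite /= eqxx !inE eqxx orbT. Qed.

Lemma schedule_signal p b i k : i != tau p ->
  (p, Signal b i k) \in schedule (p, Main (Relay b i k)).
Proof. by move=> /= /negPf ->; rewrite !inE eqxx orbT. Qed.

Lemma link_in_onext i j : onext i = Some j -> link_in j = Link i.
Proof. by move=> ij; rewrite /link_in (onext_opred ij) (onextP ij). Qed.

Lemma relay_in_onext b i k k' : onext k = Some k' -> relay_in b i k' = Signal b i k.
Proof. by move=> kk'; rewrite /relay_in (onext_opred kk') (onextP kk'). Qed.

Definition scheduled (t : gtime) (u v : gvertex) : bool :=
  (t \in schedule u) || (t \in schedule v).

Lemma scheduled_link p i r v q : (Main (Clause i), (r, v)) \in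
    local_edges conflict (forbidden p) (Link i) -> cell_at r p = Some q ->
  scheduled (p, Link i) (p, Main (Clause i)) (q, v).
Proof.
rewrite inE; case ij: (onext i) => [j|] /eqP[-> ->] /= [<-]; apply/orP; last first.
  by left; apply: schedule_link; rewrite -ltnS (onext_None ij).
have [le|lt] := leqP (tau p) i; first by left; exact: schedule_link.
by right; rewrite -(link_in_onext ij) schedule_link_in ?(onextP ij).
Qed.

Lemma scheduled_forced p w : is_forced w ->
  (p, Forced w) \in schedule (p, Main w).
Proof.
case: w => [i /eqP i0|b i k _|b i j _]; [| exact: mem_head | exact: mem_head].
by have := @schedule_link_in p i; rewrite /link_in i0 eqxx => ->.
Qed.

Lemma scheduled_select p i r v q : (Main (Clause i), (r, v)) \in
    local_edges conflict (forbidden p) (Select i) -> cell_at r p = Some q ->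
  scheduled (p, Select i) (p, Main (Clause i)) (q, v).
Proof.
have [-> e|ne _ _] := eqVneq i (tau p); last by rewrite /scheduled schedule_select.
have relay b : (p, Select (tau p)) \in schedule (p, Main (Relay b (tau p) (ofirst (tau p)))).
  exact: schedule_relay_in.
have [/(_ p)/negPf allowed _] := tau_tiling.
by move: e; rewrite !inE allowed orbF => /orP[] /eqP[-> ->] [<-]; rewrite /scheduled relay orbT.
Qed.

Lemma scheduled_signal p b i k r v q : (Main (Relay b i k), (r, v)) \in
    local_edges conflict (forbidden p) (Signal b i k) -> cell_at r p = Some q ->
  scheduled (p, Signal b i k) (p, Main (Relay b i k)) (q, v).
Proof.
have [-> e r_q|ne _ _] := eqVneq i (tau p); last by rewrite /scheduled schedule_signal.
apply/orP; right; move: e; rewrite !mem_cat => /or3P[|/nseqP[[r_b ->] bad]|/nseqP[[r_p ->] _]].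
- case kk': (onext k) => [k'|] //; rewrite inE => /eqP[r_p ->]; rewrite r_p in r_q.
  by case: r_q => <-; rewrite -(relay_in_onext _ _ kk') schedule_relay_in.
- rewrite r_b /= in r_q; have [_ /(_ b p q r_q)] := tau_tiling.
  rewrite /= (nextK r_q); case: eqVneq => [<-|_ _]; last by rewrite !inE eqxx orbT.
  by move: bad; case: conflict.
- by rewrite r_p in r_q; case: r_q => <-; rewrite /= eqxx !inE eqxx orbT.
Qed.

Lemma schedule_covers t u v : (u, v) \in gadget_edges t -> scheduled t u v.
Proof.
case: t u v => p t [p' u] [q v] /gadget_edgesP[r /= [-> r_q e]].
case: t e => [i|w|i|b i k|w i b|] e.
- move: (e); rewrite inE => /eqP[E _ _]; rewrite E in e *; exact: scheduled_link r_q.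
- by move: e; rewrite /= => /nseqP[[-> _ _]]; case E: (is_forced w);
    rewrite // /scheduled scheduled_forced.
- have E : u = Main (Clause i).
    by move: e; rewrite !inE => /or3P[/eqP[]|/eqP[]|/nseqP[[]]].
  by rewrite E in e *; exact: scheduled_select r_q.
- have E : u = Main (Relay b i k).
    move: e; rewrite !mem_cat => /or3P[|/nseqP[[]]|/nseqP[[]]] //.
    by case: (onext k) => // k'; rewrite inE => /eqP[].
  by rewrite E in e *; exact: scheduled_signal r_q.
- by move: e; rewrite inE => /eqP[-> _ _]; case: b; rewrite /scheduled !inE eqxx ?orbT.
- by move: e; rewrite !inE => /or4P[] /eqP[-> _ _]; rewrite /scheduled mem_head.
Qed.

Lemma cover_of_tiling : activity_cover gadget_edges 2 (fun v t => t \in schedule v).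
Proof.
split=> [v|]; last exact: schedule_covers.
exact: leq_trans (card_size _) (size_schedule v).
Qed.

End Completeness.

Definition occurrences (v : gvertex) : seq gtime :=
  let: (p, v) := v in
  match v with
  | Main (Clause i) => [:: (p, Forced (Clause i)); (p, Link (opred i)); (p, Link i); (p, Select i)]
  | Main (Relay b i k) =>
      [:: (p, Forced (Relay b i k)); (p, Select i); (p, Signal b i (opred k)); (p, Signal b i k)]
  | Main (Conflict b i j) =>
      [:: (p, Forced (Conflict b i j)); (p, Signal b j i);
          (odflt p (previous b p), Signal b i j)]
  | Dead w i =>
      (if w is Clause j then [:: (p, Link j); (p, Select j)] else [::]) ++
      [:: (p, Forced w); (p, Drain w i true); (p, Drain w i false);
          (p, Drain w (drain_tail i true) true); (p, Drain w (drain_tail i false) false)]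
  | Dummy _ => [:: (p, Star)]
  end.

Lemma size_occurrences v : size (occurrences v) <= 7.
Proof. by case: v => p [[i|b i k|b i j]|[i|b i k|b i j] j'|i]. Qed.

Lemma mem_consr (X : eqType) (x y : X) l : x \in l -> x \in y :: l.
Proof. by rewrite inE => ->; rewrite orbT. Qed.

Ltac mem_list := solve [repeat first [exact: mem_head | apply: mem_consr]].

Lemma gadget_edges_occurrences t u v : (u, v) \in gadget_edges t ->
  (t \in occurrences u) && (t \in occurrences v).
Proof.
case: t u v => p t [p' u] [q v] /gadget_edgesP[r /= [-> r_q e]]; apply/andP.
case: t e => [i|w|i|b i k|w i b|].
- rewrite inE; case ij: (onext i) => [j|] /eqP[-> r_p ->]; rewrite r_p in r_q;
    case: r_q => <-; split; rewrite /occurrences ?(onext_opred ij); mem_list.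
- move=> /nseqP[[-> r_p ->] _]; rewrite r_p in r_q; case: r_q => <-.
  by split; case: w => [i|b i j|b i j]; mem_list.
- rewrite !inE => /or3P[/eqP[-> r_p ->]|/eqP[-> r_p ->]|/nseqP[[-> r_p ->] _]];
    by rewrite r_p in r_q; case: r_q => <-; split; mem_list.
- rewrite !mem_cat => /or3P[|/nseqP[[-> r_b ->] _]|/nseqP[[-> r_p ->] _]].
  + case kk': (onext k) => [k'|] //; rewrite inE => /eqP[-> r_p ->]; rewrite r_p in r_q.
    case: r_q => <-; split; rewrite /occurrences ?(onext_opred kk'); mem_list.
  + by rewrite r_b in r_q; split; rewrite /occurrences ?(nextK r_q); mem_list.
  + by rewrite r_p in r_q; case: r_q => <-; split; mem_list.
- rewrite inE => /eqP[-> r_p ->]; rewrite r_p in r_q; case: r_q => <-.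
  split; rewrite /occurrences mem_cat; apply/orP; right; case: b; try mem_list.
    by rewrite -{1}(drain_headK true i); mem_list.
  by rewrite -{1}(drain_headK false i); mem_list.
- rewrite !inE => /or4P[] /eqP[-> r_p ->]; rewrite r_p in r_q; case: r_q => <-;
    by split; mem_list.
Qed.

Definition gadget_instance : tvc_instance :=
  edge_list_instance gadget_joined_irrefl (isT : 0 < 2).

Lemma gadget_yes : 0 < m -> tvc_yes gadget_instance <-> exists tau, is_tiling tau.
Proof.
move=> m_gt0; apply: iff_trans (edge_list_yes _ _) _.
split=> [[act act_cover]|[tau tau_tiling]]; first exact: tiling_of_cover act_cover m_gt0.
by eexists; exact: cover_of_tiling tau_tiling.
Qed.

Lemma gadget_each_edge_once : each_edge_once (tvc_graph gadget_instance).
Proof. exact: edge_list_each_edge_once gadget_joined_once. Qed.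

Lemma gadget_imw : P -> imw (tvc_graph gadget_instance) = 4.
Proof.
move=> p; apply/eqP; rewrite eqn_leq; apply/andP; split.
  by apply: edge_list_imw_le; [exact: gadget_joined_once | exact: size_gadget_edges].
pose leaves : seq gvertex := [seq (p, Dummy x) | x <- [:: 1; 2; 3; 4]%R].
apply: (@edge_list_imw_ge _ _ _ _ gadget_joined_once (p, Star) (p, Dummy 0%R) leaves).
  by rewrite map_inj_uniq // => x y [].
move=> _ /mapP[x x_leaf ->]; rewrite /joined; apply/orP; left; apply/gadget_edgesP.
by exists None; split=> //; apply: map_f.
Qed.

Lemma gadget_degree v : underlying_degree (tvc_graph gadget_instance) v <= 28.
Proof.
rewrite -[28]/(7 * 4).
apply: edge_list_degree_le; [exact: size_gadget_edges | exact: gadget_edges_occurrences |].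
exact: size_occurrences.
Qed.

End Gadget.

(** * Computations as tilings *)

Inductive label := LeftBlank | InputBit of bool | FreeBit | RightBlank | LaterRow.

Definition label_code (l : label) : bool + 'I_4 :=
  match l with
  | InputBit b => inl b
  | LeftBlank => inr 0%R
  | FreeBit => inr 1%R
  | RightBlank => inr 2%R
  | LaterRow => inr 3%R
  end.

Definition label_decode (x : bool + 'I_4) : label :=
  match x with
  | inl b => InputBit b
  | inr i => nth LaterRow [:: LeftBlank; FreeBit; RightBlank] i
  end.

Lemma label_codeK : cancel label_code label_decode.
Proof. by case. Qed.

HB.instance Definition _ := Finite.copy label (can_type label_codeK).

(* Position of a cell relative to a head: [None] under it, [Some b] strictly to
   its right if [b], strictly to its left otherwise. *)
Definition side := option bool.

Definition side_of (z h : int) : side := if z == h then None else Some (h < z)%R.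

Definition follows (a b : side) : bool :=
  match a, b with
  | Some false, Some true => false
  | Some false, _ => true
  | None, Some true | Some true, Some true => true
  | _, _ => false
  end.

Definition moves_to (d : move) (a b : side) : bool :=
  match d with
  | MoveS => b == a
  | MoveR => if a is Some true then b != Some false else b == Some false
  | MoveL => if a is Some false then b != Some true else b == Some true
  end.

Variant side_of_spec (z h : int) : side -> Prop :=
| UnderHead of z = h : side_of_spec z h None
| RightOfHead of (h < z)%R : side_of_spec z h (Some true)
| LeftOfHead of (z < h)%R : side_of_spec z h (Some false).

Lemma side_ofP z h : side_of_spec z h (side_of z h).
Proof.
rewrite /side_of; case: (z =P h) => [|ne]; first by constructor.
by case lt: (h < z)%R; constructor; lia.
Qed.

Lemma side_of_None z h : (side_of z h == None) = (z == h).
Proof. by rewrite /side_of; case: (z == h). Qed.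

Lemma side_of_left z h : (side_of z h == Some false) = (z < h)%R.
Proof.
case: side_ofP => [->|gt|->] //.
by apply/esym/negbTE; lia.
Qed.

Lemma follows_side_of z h : follows (side_of z h) (side_of (z + 1)%R h).
Proof. by case: side_ofP => ?; case: side_ofP => ? //=; lia. Qed.

Lemma moves_to_side_of d z h : moves_to d (side_of z h) (side_of z (h + shift d)%R).
Proof. by case: d => /=; case: side_ofP => ?; case: side_ofP => ? //=; lia. Qed.

Lemma follows_uniq N z0 h (a : nat -> side) :
  (forall j, j.+1 < N -> follows (a j) (a j.+1)) -> h < N -> a h = None ->
  forall j, j < N -> a j = side_of (Posz j - z0)%R (Posz h - z0)%R.
Proof.
move=> a_follows lt_h a_h.
have right_of d : h + d.+1 < N -> a (h + d.+1) = Some true.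
  elim: d => [|d IH] lt; rewrite addnS in lt *.
    by have := a_follows _ lt; rewrite addn0 a_h; case: (a _) => [[]|].
  by have := a_follows _ lt; rewrite IH ?(ltnW lt) //; case: (a _) => [[]|].
have left_of d : d < h -> a (h - d.+1) = Some false.
  elim: d => [|d IH] lt.
    have := a_follows (h - 1); rewrite subn1 prednK ?a_h // => /(_ lt_h).
    by case: (a _) => [[]|].
  have := a_follows (h - d.+2); rewrite subnSK // IH ?(ltnW lt) // => /(_ _).
  by case: (a _) => [[]|] // /(_ ltac:(lia)).
move=> j lt_j; case: side_ofP => ?.
- by rewrite (_ : j = h) //; lia.
- by rewrite (_ : j = h + (j - h).-1.+1) ?right_of //; lia.
- by rewrite (_ : j = h - (h - j).-1.+1) ?left_of //; lia.
Qed.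

Lemma moves_to_uniq N z0 h d (a : nat -> side) :
  (forall j, j.+1 < N -> follows (a j) (a j.+1)) -> 0 < h -> h.+1 < N ->
  (forall j, j < N -> moves_to d (side_of (Posz j - z0)%R (Posz h - z0)%R) (a j)) ->
  forall j, j < N -> a j = side_of (Posz j - z0)%R (Posz h - z0 + shift d)%R.
Proof.
move=> a_follows h_gt0 lt_h a_moves.
suff [h' lt_h' [head_h' a_h']] : exists2 h', h' < N &
    (Posz h' - z0 = Posz h - z0 + shift d)%R /\ a h' = None.
  by rewrite -head_h'; exact: follows_uniq a_h'.
have lt_h0 := ltnW lt_h; have := a_moves h lt_h0.
rewrite (_ : side_of _ _ = None); last by apply/eqP; rewrite side_of_None.
case: d a_moves => /= a_moves /eqP a_h.
- have lt_p := leq_ltn_trans (leq_pred h) lt_h0.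
  exists h.-1 => //; split; first by lia.
  have := a_follows h.-1; rewrite prednK // a_h => /(_ lt_h0).
  have := a_moves _ lt_p; rewrite (_ : side_of _ _ = Some false).
    by case: (a _) => [[]|].
  by apply/eqP; rewrite side_of_left; lia.
- by exists h; rewrite ?GRing.addr0.
- exists h.+1 => //; split; first by lia.
  have := a_follows h lt_h; rewrite a_h; have := a_moves _ lt_h.
  by case: side_ofP => ?; case: (a _) => [[]|] //; lia.
Qed.

Section Tiles.
Variable M : TM.
Local Notation tape := 'I_(tm_tapes M).+1.
Local Notation blank := (tm_blank M).

(* [origin] is the side of the column relative to cell 0 of the tapes; [initial] marks
   the first row. *)
Definition tile := (side * bool * tm_state M * {ffun tape -> tm_sym M}
                    * {ffun tape -> tm_sym M * side})%type.

Definition origin (s : tile) : side := s.1.1.1.1.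
Definition initial (s : tile) : bool := s.1.1.1.2.
Definition tile_state (s : tile) : tm_state M := s.1.1.2.
Definition scanned (s : tile) : {ffun tape -> tm_sym M} := s.1.2.
Definition symbol (s : tile) (k : tape) : tm_sym M := (s.2 k).1.
Definition head_side (s : tile) (k : tape) : side := (s.2 k).2.

Definition transition (q : tm_state M) (r : {ffun tape -> tm_sym M}) :=
  if tm_halt q then (q, [ffun k => (r k, MoveS)]) else tm_delta q r.

(* The last clause makes the blanks of the first row follow the guessed word. *)
Definition row_ok (s s' : tile) : bool :=
  [&& follows (origin s) (origin s'), tile_state s == tile_state s',
      scanned s == scanned s', [forall k, follows (head_side s k) (head_side s' k)]
    & [&& initial s, initial s', origin s != Some false & symbol s ord0 == blank] ==>
      (symbol s' ord0 == blank)].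

Definition column_ok (s s' : tile) : bool :=
  let: (q, act) := transition (tile_state s) (scanned s) in
  [&& origin s' == origin s, tile_state s' == q
    & [forall k, (symbol s' k == if head_side s k == None then (act k).1 else symbol s k)
                 && moves_to (act k).2 (head_side s k) (head_side s' k)]].

Definition input_ok (l : label) (c : tm_sym M) : bool :=
  match l with
  | InputBit b => c == tm_bit M b
  | FreeBit => c \in [:: tm_bit M true; tm_bit M false; blank]
  | _ => c == blank
  end.

Definition initial_ok (l : label) (s : tile) : bool :=
  [&& initial s, tile_state s == tm_start M, (origin s == Some false) == (l == LeftBlank),
      [forall k, head_side s k == origin s], [forall k, (k != ord0) ==> (symbol s k == blank)]
    & input_ok l (symbol s ord0)].

Definition tile_ok (l : label) (s : tile) : bool :=
  [&& [forall k, (head_side s k == None) ==> (symbol s k == scanned s k)],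
      tm_halt (tile_state s) && (origin s == None) ==> (symbol s ord_max == tm_bit M true)
    & if l == LaterRow then ~~ initial s else initial_ok l s].

End Tiles.

Lemma bit_word (T : eqType) (blank : T) (bit : bool -> T) B (a : nat -> T) :
  (forall i, i < B -> a i \in [:: bit true; bit false; blank]) ->
  (forall i, i.+1 < B -> a i = blank -> a i.+1 = blank) ->
  exists2 y, size y <= B & forall i, i < B -> a i = nth blank (map bit y) i.
Proof.
elim: B a => [|B IH] a a_bit a_blank; first by exists [::].
have [a0|a0] := eqVneq (a 0) blank.
  exists [::] => // i; rewrite nth_nil; elim: i => // i IHi lt.
  by apply: a_blank => //; apply: IHi; exact: ltnW.
have [y le_y a_y] := IH (a \o succn) (fun i => a_bit i.+1) (fun i => a_blank i.+1).
have [b a_b] : exists b, a 0 = bit b.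
  by have := a_bit 0 isT; rewrite !inE (negPf a0) orbF => /orP[] /eqP; [exists true|exists false].
by exists (b :: y) => // -[|i] lt //=; exact: a_y.
Qed.

Section FirstRow.
Variables (S B : nat) (w : seq bool).

Definition first_row : seq label :=
  nseq S.+1 LeftBlank ++ map InputBit w ++ nseq B FreeBit ++ nseq S.+1 RightBlank.

Arguments first_row : simpl never.

Local Notation N := (size first_row).

Definition row_label (r j : nat) : label := if r == 0 then nth LaterRow first_row j else LaterRow.

Definition column (j : nat) : int := (Posz j - Posz S.+1)%R.

Variant first_row_spec (j : nat) : label -> int -> Prop :=
| InLeftBlank z of j <= S : first_row_spec j LeftBlank (Negz z)
| InInput i of j = S.+1 + i & i < size w :
    first_row_spec j (InputBit (nth false w i)) (Posz i)
| InFree i of j = S.+1 + (size w + i) & i < B : first_row_spec j FreeBit (Posz (size w + i))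
| InRightBlank i of j = S.+1 + (size w + (B + i)) :
    first_row_spec j RightBlank (Posz (size w + (B + i))).

Lemma size_first_row : N = S.+1 + (size w + (B + S.+1)).
Proof. by rewrite !size_cat !size_nseq size_map. Qed.

Lemma first_rowP j : j < N -> first_row_spec j (nth LaterRow first_row j) (column j).
Proof.
rewrite size_first_row /first_row !nth_cat !size_nseq size_map !nth_nseq /column => lt_j.
have [lt|le] := ltnP j S.+1.
  by rewrite (_ : (_ - _)%R = Negz (S - j)); [constructor | lia].
have [i Ej] : exists i, j = S.+1 + i by exists (j - S.+1); lia.
rewrite {}Ej in lt_j le *; rewrite addKn (_ : (_ - _)%R = Posz i); last lia.
have [lt_i|le_i] := ltnP i (size w).
  by rewrite (nth_map false) //; constructor; lia.
have [i' Ei] : exists i', i = size w + i' by exists (i - size w); lia.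
rewrite {}Ei in lt_j le_i *; rewrite addKn.
have [lt_i'|le_i'] := ltnP i' B; first by constructor; lia.
rewrite (_ : i' - B < S.+1); last lia.
by rewrite -(subnKC le_i'); constructor; lia.
Qed.

Lemma row_label_neq_later j : j < N -> row_label 0 j != LaterRow.
Proof. by rewrite /row_label => /first_rowP[]. Qed.

Lemma row_label_left j : j < N -> (row_label 0 j == LeftBlank) = (column j < 0)%R.
Proof. by rewrite /row_label => /first_rowP[]. Qed.

Variable M : TM.

Lemma word_tapeE (u : seq bool) i : word_tape M u (Posz i) = nth (tm_blank M) (map (@tm_bit M) u) i.
Proof. by []. Qed.

Lemma input_ok_word y j : size y <= B -> j < N ->
  input_ok (row_label 0 j) (word_tape M (w ++ y) (column j)).
Proof.
rewrite /row_label => le_y /first_rowP[z|i _ lt_i|i _ lt_i|i _] //=.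
- by rewrite (nth_map false) ?size_cat ?nth_cat ?lt_i // ltn_addr.
- rewrite map_cat nth_cat size_map ltnNge leq_addr /= addKn !inE.
  have [lt_y|le_i] := ltnP i (size y); last by rewrite nth_default ?size_map ?eqxx ?orbT.
  by rewrite (nth_map false) //; case: nth; rewrite eqxx ?orbT.
- by rewrite nth_default // size_map size_cat; lia.
Qed.

Lemma word_of_input_ok (a : nat -> tm_sym M) :
  (forall j, j < N -> input_ok (row_label 0 j) (a j)) ->
  (forall j, S < j -> j.+1 < N -> a j = tm_blank M -> a j.+1 = tm_blank M) ->
  exists2 y, size y <= B & forall j, j < N -> a j = word_tape M (w ++ y) (column j).
Proof.
move=> a_ok a_blank; have size_N := size_first_row.
have free_ok i : i < B -> input_ok FreeBit (a (S.+1 + (size w + i))).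
  move=> lt_i; have lt_j : S.+1 + (size w + i) < N by lia.
  by have := a_ok _ lt_j; rewrite /row_label; case: (first_rowP lt_j) => // *; lia.
have [i lt_i|y le_y a_y] := bit_word free_ok.
  by rewrite !addnS; apply: a_blank; lia.
exists y => // j lt_j; move: (a_ok j lt_j); rewrite /row_label.
case: (first_rowP lt_j) => [z _ /eqP //|i -> lt_i /eqP ->|i Ej lt_i _|i Ej /eqP ->].
- by rewrite word_tapeE (nth_map false) ?size_cat ?nth_cat ?lt_i // ltn_addr.
- by rewrite word_tapeE map_cat nth_cat size_map ltnNge leq_addr /= addKn Ej a_y.
- by rewrite word_tapeE nth_default // size_map size_cat; lia.
Qed.

End FirstRow.

Lemma size_delimit w : size (delimit w) = 2 * size w + 1.
Proof. by rewrite /delimit size_cat /=; elim: w => //= b w; lia. Qed.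

Section Tableaux.
Variables (M : TM) (V : seq bool -> bool) (t : nat -> nat).
Hypothesis computes_V : computes_in_time M (fun w => [:: V w]) t.
Variables (S B : nat) (x : seq bool).
Hypothesis time_le : forall y, size y <= B -> t (size (pair_code x y)) <= S.

Local Notation tape := 'I_(tm_tapes M).+1.
Local Notation N := (size (first_row S B (delimit x))).
Local Notation row_label := (row_label S B (delimit x)).
Local Notation column := (column S).

Definition is_tableau (g : nat -> nat -> tile M) : Prop :=
  [/\ forall r j, r <= S -> j < N -> tile_ok (row_label r j) (g r j),
      forall r j, r <= S -> j.+1 < N -> row_ok (g r j) (g r j.+1)
    & forall r j, r < S -> j < N -> column_ok (g r j) (g r.+1 j)].

Definition run (y : seq bool) (r : nat) : config M :=
  iter r (@step M) (init_config M (pair_code x y)).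

Definition scan (c : config M) : {ffun tape -> tm_sym M} :=
  [ffun k => c_tape c k (c_head c k)].

Lemma step_transition (c : config M) :
  let: (q, act) := transition (c_state c) (scan c) in
  [/\ c_state (step c) = q,
      forall k z, c_tape (step c) k z =
        if z == c_head c k then (act k).1 else c_tape c k z
    & forall k, c_head (step c) k = (c_head c k + shift (act k).2)%R].
Proof.
rewrite /transition /step; case: ifP => halted; last first.
  by rewrite -/(scan c); case: tm_delta.
split=> [|k z|k] //; rewrite !ffunE //= ?GRing.addr0 //.
by case: eqP => // ->.
Qed.

Lemma size_row : 2 * S.+1 < N.
Proof. by rewrite size_first_row size_delimit; lia. Qed.

Lemma columnS j : column j.+1 = (column j + 1)%R.
Proof. by rewrite /column; lia. Qed.

Lemma run_head y r k : (- Posz r <= c_head (run y r) k <= Posz r)%R.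
Proof.
elim: r => //= r IH; have := step_transition (run y r).
case: transition => q act [_ _ ->]; case: (act k).2 => /=; lia.
Qed.

Lemma head_column y r k : r <= S ->
  exists h, [/\ c_head (run y r) k = column h, 0 < h & h.+1 < N].
Proof.
move=> le_r; have := run_head y r k; have := size_row => lt_N bounds.
by exists (absz (c_head (run y r) k + Posz S.+1)%R); rewrite /column; split; lia.
Qed.

Lemma run_halted y r r' : r <= r' -> tm_halt (c_state (run y r)) -> run y r' = run y r.
Proof.
move=> le halted; rewrite -(subnK le) /run iterD -/(run y r).
by elim: (r' - r) => //= i ->; rewrite /step halted.
Qed.

Lemma run_output y r : tm_halt (c_state (run y r)) ->
  c_tape (run y r) ord_max 0%R = tm_bit M (V (pair_code x y)).
Proof.
move=> halted; have := computes_V (pair_code x y); cbv zeta.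
rewrite -/(run y _); set T := t _ => -[halted_T output_T].
suff -> : run y r = run y T by rewrite output_T.
by case: (leqP r T) => [le|/ltnW le]; rewrite (run_halted le).
Qed.

Section TableauOfRun.
Variable y : seq bool.
Hypotheses (size_y : size y <= B) (accepts : V (pair_code x y)).

Definition run_tile (r j : nat) : tile M :=
  let c := run y r in
  (side_of (column j) 0, r == 0, c_state c, scan c,
   [ffun k => (c_tape c k (column j), side_of (column j) (c_head c k))]).

Lemma run_tile_initial_ok j : j < N -> initial_ok (row_label 0 j) (run_tile 0 j).
Proof.
move=> lt_j; rewrite /initial_ok /origin /= row_label_left // side_of_left !eqxx /=.
apply/and3P; split.
- by apply/forallP => k; rewrite /head_side /= ffunE.
- apply/forallP => k; apply/implyP => /negPf k_neq0; rewrite /symbol /= ffunE /= k_neq0.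
  by rewrite /word_tape; case: column => // i; rewrite nth_nil.
- by rewrite /symbol /= ffunE; exact: input_ok_word.
Qed.

Lemma run_tile_ok r j : j < N -> tile_ok (row_label r j) (run_tile r j).
Proof.
move=> lt_j; apply/and3P; split.
- apply/forallP => k; apply/implyP; rewrite /head_side /symbol /scanned /= !ffunE /=.
  by rewrite side_of_None => /eqP ->.
- apply/implyP => /andP[halted]; rewrite /origin /symbol /= ffunE /= side_of_None.
  by move=> /eqP ->; rewrite run_output // accepts.
- case: r => [|r] //; rewrite (negPf (row_label_neq_later lt_j)); exact: run_tile_initial_ok.
Qed.

Lemma run_row_ok r j : row_ok (run_tile r j) (run_tile r j.+1).
Proof.
rewrite /row_ok /origin /tile_state /scanned !eqxx /= columnS follows_side_of /=.
apply/andP; split; first apply/forallP => k.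
  by rewrite /head_side /= !ffunE /= columnS follows_side_of.
apply/implyP => /and3P[/eqP -> _]; rewrite side_of_left /symbol /= !ffunE /= columnS.
case: (column j) => // i /andP[_]; rewrite (_ : (Posz i + 1)%R = i.+1); last lia.
have [lt_i|le_i] := ltnP i (size (pair_code x y)).
  by rewrite !word_tapeE (nth_map false) // (negPf (@tm_bit_blank M _)).
by rewrite !word_tapeE !(nth_default, size_map) ?leqW // size_map leqW.
Qed.

Lemma run_column_ok r j : column_ok (run_tile r j) (run_tile r.+1 j).
Proof.
rewrite /column_ok /tile_state /scanned /=.
have := step_transition (run y r); case: transition => q act [state_q tape_act head_act].
rewrite -state_q !eqxx /=; apply/forallP => k.
by rewrite /symbol /head_side /= !ffunE /= tape_act head_act moves_to_side_of side_of_None eqxx.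
Qed.

Lemma tableau_of_run : is_tableau run_tile.
Proof.
by split=> *; [exact: run_tile_ok | exact: run_row_ok | exact: run_column_ok].
Qed.

End TableauOfRun.

Section RunOfTableau.
Variable g : nat -> nat -> tile M.
Hypothesis g_tableau : is_tableau g.

Let g_tile : forall r j, r <= S -> j < N -> tile_ok (row_label r j) (g r j).
Proof. by case: g_tableau. Qed.

Let g_row : forall r j, r <= S -> j.+1 < N -> row_ok (g r j) (g r j.+1).
Proof. by case: g_tableau. Qed.

Let g_column : forall r j, r < S -> j < N -> column_ok (g r j) (g r.+1 j).
Proof. by case: g_tableau. Qed.

Lemma first_row_initial j : j < N -> initial_ok (row_label 0 j) (g 0 j).
Proof.
move=> lt_j; have /and3P[_ _] := g_tile (leq0n S) lt_j.
by rewrite (negPf (row_label_neq_later lt_j)).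
Qed.

Lemma origin_column r j : r <= S -> j < N -> origin (g r j) = side_of (column j) 0.
Proof.
move=> le_r lt_j; have -> : origin (g r j) = origin (g 0 j).
  elim: r le_r => // r IH lt_r; rewrite -IH ?(ltnW lt_r) //.
  by have := g_column lt_r lt_j; rewrite /column_ok; case: transition => q act /and3P[/eqP].
have lt_N := size_row.
have origin_left i : i < N -> (origin (g 0 i) == Some false) = (column i < 0)%R.
  by move=> lt_i; have /and5P[_ _ /eqP ->] := first_row_initial lt_i; rewrite row_label_left.
have origin_follows i : i.+1 < N -> follows (origin (g 0 i)) (origin (g 0 i.+1)).
  by move=> lt_i; have /and5P[] := g_row (leq0n S) lt_i.
have column0 : column S.+1 = 0%R by rewrite /column; lia.
rewrite -column0; apply: (@follows_uniq N (Posz S.+1) S.+1 (fun i => origin (g 0 i))) => //.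
  by lia.
have lt_S : S.+1 < N by lia.
have := origin_follows S lt_S; have := origin_left _ lt_S; rewrite column0.
have := origin_left S (ltnW lt_S); rewrite (_ : (_ < _)%R) => [/eqP ->|];
  last by rewrite /column; lia.
by case: (origin _) => [[]|].
Qed.

Lemma scanned_row r i j : r <= S -> i < N -> j < N -> scanned (g r i) = scanned (g r j).
Proof.
move=> le_r lt_i lt_j; have scanned0 h : h < N -> scanned (g r h) = scanned (g r 0).
  elim: h => // h IH lt_h; have /and5P[_ _ /eqP <- _ _] := g_row le_r lt_h.
  by apply: IH; exact: ltnW.
by rewrite !scanned0.
Qed.

Definition shows (c : config M) (r : nat) : Prop := forall j, j < N -> forall k,
  symbol (g r j) k = c_tape c k (column j) /\
  head_side (g r j) k = side_of (column j) (c_head c k).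

Definition represents (c : config M) (r : nat) : Prop :=
  shows c r /\ forall j, j < N -> tile_state (g r j) = c_state c.

Lemma scanned_shows y r j : r <= S -> shows (run y r) r -> j < N ->
  scanned (g r j) = scan (run y r).
Proof.
move=> le_r shows_r lt_j; apply/ffunP => k; rewrite ffunE.
have [h [head_h _ /ltnW lt_h]] := head_column y k le_r.
rewrite (scanned_row le_r lt_j lt_h) head_h; have [<- side_h] := shows_r h lt_h k.
have /and3P[/forallP/(_ k) + _ _] := g_tile le_r lt_h.
by rewrite side_h head_h side_of_None eqxx /= => /eqP.
Qed.

Lemma represents_first_row : exists2 y, size y <= B & represents (run y 0) 0.
Proof.
have initial_j j lt_j := first_row_initial (j := j) lt_j.
have [j lt_j|j lt_S lt_j blank_j|y le_y word_y] :=
    @word_of_input_ok S B (delimit x) M (fun j => symbol (g 0 j) ord0).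
- by have /and5P[_ _ _ _ /andP[]] := initial_j j lt_j.
- have /and5P[_ _ _ _ /implyP blank_next] := g_row (leq0n S) lt_j.
  apply/eqP/blank_next; rewrite blank_j eqxx andbT origin_column ?(ltnW lt_j) //.
  have /and3P[-> _ _] := initial_j j (ltnW lt_j); have /and3P[-> _ _] := initial_j _ lt_j.
  by rewrite side_of_left /column; lia.
exists y => //; split=> [j lt_j k|j lt_j]; last by have /and5P[_ /eqP] := initial_j j lt_j.
have /and5P[_ _ _ /forallP sides /andP[/forallP others _]] := initial_j j lt_j.
split; last by rewrite (eqP (sides k)) origin_column.
have [->|k_neq0] := eqVneq k ord0; first exact: word_y.
rewrite (eqP (implyP (others k) k_neq0)) /= (negPf k_neq0).
by rewrite /word_tape; case: column => // i; rewrite nth_nil.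
Qed.

Lemma represents_step y r : r < S -> represents (run y r) r -> represents (run y r.+1) r.+1.
Proof.
move=> lt_r [shows_r state_r].
have := step_transition (run y r); case Et : transition => [q act] [state_q tape_act head_act].
have next_tile j : j < N -> tile_state (g r.+1 j) = q /\ forall k,
    symbol (g r.+1 j) k = c_tape (run y r.+1) k (column j) /\
    moves_to (act k).2 (side_of (column j) (c_head (run y r) k)) (head_side (g r.+1 j) k).
  move=> lt_j; have := g_column lt_r lt_j; rewrite /column_ok state_r //.
  rewrite (scanned_shows (ltnW lt_r) shows_r lt_j) Et => /and3P[_ /eqP-> /forallP tapes_ok].
  split=> // k; have /andP[/eqP -> moves_k] := tapes_ok k.
  have [symbol_k side_k] := shows_r j lt_j k; rewrite side_k in moves_k *; split=> //.
  by rewrite symbol_k side_of_None [run y r.+1]/= tape_act.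
split=> [j lt_j k|j lt_j]; last by have [-> _] := next_tile j lt_j.
split; first by have [_ /(_ k)[]] := next_tile j lt_j.
have [h [head_h h_gt0 lt_h]] := head_column y k (ltnW lt_r).
rewrite [run y r.+1]/= head_act head_h.
apply: (@moves_to_uniq N (Posz S.+1) h _ (fun i => head_side (g r.+1 i) k)) lt_j => // i lt_i.
  by have /and5P[_ _ _ /forallP/(_ k)] := g_row lt_r lt_i.
by have [_ /(_ k)[_]] := next_tile i lt_i; rewrite head_h.
Qed.

Lemma run_of_tableau : exists2 y, size y <= B & V (pair_code x y).
Proof.
have [y le_y represents0] := represents_first_row; exists y => //.
have [shows_S state_S] : represents (run y S) S.
  suff: forall r, r <= S -> represents (run y r) r by exact.
  by elim=> // r IH lt_r; apply: represents_step => //; apply: IH; exact: ltnW.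
have halted : tm_halt (c_state (run y S)).
  have := computes_V (pair_code x y); cbv zeta; rewrite -/(run y _) => -[halted_t _].
  by rewrite (run_halted (time_le le_y)).
have lt_O : S.+1 < N by have := size_row; lia.
have column0 : column S.+1 = 0%R by rewrite /column; lia.
have /and3P[_ + _] := g_tile (leqnn S) lt_O.
rewrite state_S // halted origin_column // column0 side_of_None eqxx /=.
have [-> _] := shows_S _ lt_O ord_max; rewrite column0 run_output //.
by case: (V _) => // /eqP/tm_bit_inj.
Qed.

End RunOfTableau.

Lemma tableauP : (exists g, is_tableau g) <-> exists y, size y <= B /\ V (pair_code x y).
Proof.
split=> [[g g_tableau]|[y [le_y accepts]]].
  by have [y le_y accepts] := run_of_tableau g_tableau; exists y.
by eexists; exact: tableau_of_run le_y accepts.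
Qed.

End Tableaux.

(** * Tableaux as tilings of a grid *)

Section Grid.
Variables m n : nat.

Definition grid_next (b : bool) (p : 'I_m * 'I_n) : option ('I_m * 'I_n) :=
  if b then omap (fun r => (r, p.2)) (onext p.1) else omap (fun j => (p.1, j)) (onext p.2).

Lemma grid_next_val b p q : grid_next b p = Some q <->
  q.1 = p.1 + b :> nat /\ q.2 = p.2 + ~~ b :> nat.
Proof.
case: p q => [r j] [r' j']; case: b; rewrite /= addn0 addn1.
  split=> [|[/onext_val -> /val_inj ->] //].
  by case E: (onext r) => [r1|] //= [<- <-]; rewrite (onextP E).
split=> [|[/val_inj -> /onext_val ->] //].
by case E: (onext j) => [j1|] //= [<- <-]; rewrite (onextP E).
Qed.

Lemma grid_next_neq b p : grid_next b p != Some p.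
Proof. by apply/eqP => /grid_next_val[]; case: b => /=; lia. Qed.

Lemma grid_next_inj b p p' q : grid_next b p = Some q -> grid_next b p' = Some q -> p = p'.
Proof.
move=> /grid_next_val[r_q j_q] /grid_next_val[r'_q j'_q].
by case: p p' r_q j_q r'_q j'_q => [r j] [r' j'] /= *; congr pair; apply: val_inj => /=; lia.
Qed.

End Grid.

Section TableauTiling.
Variables (M : TM) (S B : nat) (x : seq bool).
Local Notation N := (size (first_row S B (delimit x))).
Local Notation tile_index := 'I_#|{: tile M}|.

Definition tile_conflict (b : bool) (i j : tile_index) : bool :=
  ~~ (if b then @column_ok M else @row_ok M) (enum_val i) (enum_val j).

Definition tile_forbidden (l : label) (i : tile_index) : bool :=
  ~~ tile_ok l (enum_val i : tile M).

Definition blank_tile : tile M :=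
  (None, true, tm_start M, [ffun=> tm_blank M], [ffun=> (tm_blank M, None)]).

Lemma tableau_tiling :
  (exists tau, is_tiling tile_conflict (@grid_next S.+1 N)
     (fun p => tile_forbidden (row_label S B (delimit x) p.1 p.2)) tau) <->
  (exists g : nat -> nat -> tile M, is_tableau S B x g).
Proof.
split=> [[tau [allowed compatible]]|[g [g_tile g_row g_column]]].
  pose g (r j : nat) : tile M :=
    if (insub r : option 'I_S.+1, insub j : option 'I_N) is (Some r, Some j)
    then enum_val (tau (r, j)) else blank_tile.
  have gE (r : 'I_S.+1) (j : 'I_N) : g r j = enum_val (tau (r, j)) by rewrite /g !valK.
  have next_ok (b : bool) (r r' : 'I_S.+1) (j j' : 'I_N) :
      r' = r + b :> nat -> j' = j + ~~ b :> nat ->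
      (if b then @column_ok M else @row_ok M) (g r j) (g r' j').
    move=> r_b j_b; rewrite !gE; apply/negPn/compatible; exact/grid_next_val.
  exists g; split=> r j lt_r lt_j.
  - have := allowed (Ordinal (lt_r : r < S.+1), Ordinal lt_j).
    by rewrite negbK -gE.
  - by apply: (next_ok false (Ordinal (lt_r : r < S.+1)) (Ordinal (lt_r : r < S.+1))
      (Ordinal (ltnW lt_j)) (Ordinal lt_j)); rewrite /= ?addn0 ?addn1.
  - by apply: (next_ok true (Ordinal (ltnW lt_r : r < S.+1)) (Ordinal (lt_r : r.+1 < S.+1))
      (Ordinal lt_j) (Ordinal lt_j)); rewrite /= ?addn0 ?addn1.
exists (fun p : 'I_S.+1 * 'I_N => enum_rank (g p.1 p.2)); split=> [p|b p q /grid_next_val[r_q j_q]].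
  by rewrite /tile_forbidden enum_rankK negbK g_tile // -ltnS.
have := ltn_ord q.2; have := ltn_ord q.1; rewrite /tile_conflict !enum_rankK negbK r_q j_q.
by case: b {r_q j_q} => /=; rewrite addn0 addn1 => lt_r lt_j; [apply: g_column | apply: g_row].
Qed.

End TableauTiling.

(** * The reduction is computed in polynomial time *)

(* The cells that a snapshot of the gadget involves are the owner of the snapshot
   ([None]) and the cells of the two endpoints of an edge ([Some e]). [Rows] and
   [Cols] have one letter for each row and each column; [Ruler true e] and
   [Ruler false e] measure the vertical and the horizontal distance from the owner to
   an endpoint. [Power] tapes hold powers of the sizes of [Input] and of [Length]. *)
Inductive tape_of (D : nat) :=
| Input | Guess | Length | Horizon | Output
| Rows of option bool
| Cols of option bool
| Ruler of bool & bool
| Power of bool & 'I_D.+1.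

Arguments Input {D}.
Arguments Guess {D}.
Arguments Length {D}.
Arguments Horizon {D}.
Arguments Output {D}.
Arguments Rows {D}.
Arguments Cols {D}.
Arguments Ruler {D}.

Section TapeFinite.
Variable D : nat.

Definition tape_code (i : tape_of D) :
    'I_5 + (option bool + (option bool + (bool * bool + bool * 'I_D.+1))) :=
  match i with
  | Input => inl 0%R
  | Guess => inl 1%R
  | Length => inl 2%R
  | Horizon => inl 3%R
  | Output => inl 4%R
  | Rows c => inr (inl c)
  | Cols c => inr (inr (inl c))
  | Ruler v e => inr (inr (inr (inl (v, e))))
  | Power b i => inr (inr (inr (inr (b, i))))
  end.

Definition tape_decode
    (x : 'I_5 + (option bool + (option bool + (bool * bool + bool * 'I_D.+1)))) : tape_of D :=
  match x with
  | inl i => nth Input [:: Input; Guess; Length; Horizon; Output] i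
  | inr (inl c) => Rows c
  | inr (inr (inl c)) => Cols c
  | inr (inr (inr (inl (v, e)))) => Ruler v e
  | inr (inr (inr (inr (b, i)))) => Power b i
  end.

Lemma tape_codeK : cancel tape_code tape_decode.
Proof. by case. Qed.

HB.instance Definition _ := Finite.copy (tape_of D) (can_type tape_codeK).

End TapeFinite.

Lemma flatten_map_prod (X Y : finType) (T : Type) (F : X * Y -> seq T) :
  flatten [seq F p | p <- enum {: X * Y}] =
  flatten [seq flatten [seq F (a, b) | b <- enum Y] | a <- enum X].
Proof.
have -> : enum {: X * Y} = [seq (a, b) | a <- enum X, b <- enum Y].
  by rewrite [LHS]enumT [in LHS]unlock.
by elim: (enum X) => //= a l IH; rewrite map_cat flatten_cat IH -map_comp.
Qed.

Lemma mkseq_ord (T : Type) (F : nat -> T) n : mkseq F n = [seq F (val i) | i <- enum 'I_n].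
Proof. by rewrite /mkseq -val_enum_ord -map_comp. Qed.

Section Reduction.
Variables (m : nat) (conflict : bool -> rel 'I_m) (forbid : label -> pred 'I_m).
Variables cy dy ct dt : nat.

Definition guess (n : nat) : nat := cy * n ^ dy + cy.
Definition word_size (n : nat) : nat := 2 * n + 1 + guess n.
Definition horizon (n : nat) : nat := ct * word_size n ^ dt + ct.

Definition top_row (x : seq bool) : seq label :=
  first_row (horizon (size x)) (guess (size x)) (delimit x).

Local Notation row_number x := (horizon (size x)).+1.
Local Notation col_number x := (size (top_row x)).
Local Notation grid x := ('I_(row_number x) * 'I_(col_number x))%type.

Definition cell_label (x : seq bool) (p : grid x) : label :=
  row_label (horizon (size x)) (guess (size x)) (delimit x) p.1 p.2.

Definition reduct (x : seq bool) : tvc_instance :=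
  gadget_instance conflict (@grid_next (row_number x) (col_number x))
    (fun p => forbid (cell_label p)).

Definition reduct_joined x : grid x * time m -> rel (grid x * vertex m) :=
  joined (gadget_edges conflict (@grid_next _ _) (fun p => forbid (cell_label p))).

Local Notation tape := (tape_of (dy + dt)).

Definition letter := (bool + label)%type.
Definition bit (b : bool) : letter := inl b.
Definition lab (l : label) : letter := inr l.

Local Notation one := (bit true).

(* The letter at offset [d] tells whether a row (or column) lies [d = 0] or [d = 1]
   rows (or columns) after that of the owner. *)
Definition ruler : seq letter := [:: bit false; bit true].

(* [Some None] for the owner itself, [Some (Some b)] for its next cell in direction [b]. *)
Definition relation (dr dc : option letter) : option (option bool) :=
  match dr, dc with
  | Some (inl false), Some (inl false) => Some None
  | Some (inl true), Some (inl false) => Some (Some true)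
  | Some (inl false), Some (inl true) => Some (Some false)
  | _, _ => None
  end.

Lemma cell_ruler (i j : nat) : cell ruler (Posz j - Posz i)%R =
  if j == i then Some (bit false) else if j == i.+1 then Some (bit true) else None.
Proof.
case: eqVneq => [->|ne]; first by rewrite GRing.subrr.
case: eqVneq => [->|ne']; first by rewrite (_ : (_ - _)%R = Posz 1); last lia.
case E: (_ - _)%R => [[|[|d]]|d] //=; last by rewrite onth_default.
  by lia.
by lia.
Qed.

Lemma relation_ruler x (q p : grid x) r :
  (relation (cell ruler (Posz p.1 - Posz q.1)%R) (cell ruler (Posz p.2 - Posz q.2)%R) == Some r)
  = (cell_at (@grid_next _ _) r q == Some p).
Proof.
have cell_atP : cell_at (@grid_next _ _) r q = Some p <->
    p.1 = q.1 + (r == Some true) :> nat /\ p.2 = q.2 + (r == Some false) :> nat.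
  case: r => [b|] /=; first by apply: iff_trans (grid_next_val _ _ _) _; case: b.
  case: p q => [r j] [r' j'] /=; rewrite !addn0.
  by split=> [[-> ->]|[/val_inj -> /val_inj ->]].
rewrite !cell_ruler; apply/eqP/eqP => [|/cell_atP[-> ->]]; last first.
  by case: r {cell_atP} => [[]|]; rewrite /= ?addn0 ?addn1 !eqxx ?gtn_eqF.
move=> related; apply/cell_atP; move: related.
case: eqVneq => [->|_]; last case: eqVneq => [->|_] //;
  (case: eqVneq => [->|_]; last case: eqVneq => [->|_] //) => //= -[<-];
  by rewrite ?addn0 ?addn1.
Qed.

Definition position x (q p : grid x) : option (option bool) :=
  relation (cell ruler (Posz p.1 - Posz q.1)%R) (cell ruler (Posz p.2 - Posz q.2)%R).

Definition local_edge (l : label) (h : time m) (u v : option (option bool) * vertex m) : bool :=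
  (u.1 == Some None) &&
  (if v.1 is Some r then (u.2, (r, v.2)) \in local_edges conflict (forbid l) h else false).

Lemma reduct_joined_local x (q p p' : grid x) h g g' :
  reduct_joined (q, h) (p, g) (p', g') =
  local_edge (cell_label q) h (position q p, g) (position q p', g') ||
  local_edge (cell_label q) h (position q p', g') (position q p, g).
Proof.
suff edge_local a b i j : ((a, i), (b, j)) \in gadget_edges conflict (@grid_next _ _)
    (fun p => forbid (cell_label p)) (q, h) =
    local_edge (cell_label q) h (position q a, i) (position q b, j).
  by rewrite /reduct_joined /joined !edge_local.
apply/gadget_edgesP/andP => /= [[r [-> q_b e]]|[/eqP a_q]].
  have /eqP -> : position q b == Some r by rewrite relation_ruler q_b.
  by rewrite relation_ruler.
case b_q: (position q b) => [r|] // e; exists r; split=> //.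
  by have := relation_ruler q a None; rewrite -/(position q a) a_q eqxx => /esym/eqP[->].
by apply/eqP; rewrite -relation_ruler -/(position q b) b_q.
Qed.

Definition scanned_label (scan : tape -> option letter) : label :=
  if (scan (Rows None), scan (Cols None)) is (Some (inl true), Some (inr l)) then l
  else LaterRow.

Definition edge_bit (h : time m) (g g' : vertex m) (scan : tape -> option letter) : letter :=
  let u := (relation (scan (Ruler true false)) (scan (Ruler false false)), g) in
  let v := (relation (scan (Ruler true true)) (scan (Ruler false true)), g') in
  bit (local_edge (scanned_label scan) h u v || local_edge (scanned_label scan) h v u).

(* The loop visits all cells, moving the heads of the rulers of the endpoints [es] in
   direction [b]. *)
Definition for_cells (c : option bool) (es : seq bool) (b : bool) (g : loop tape letter) :
    loop tape letter :=
  For (Rows c) [seq (Ruler true e, b) | e <- es]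
    (For (Cols c) [seq (Ruler false e, b) | e <- es] g).

Definition visit x c es b (p : grid x) (s : tapes tape letter) : tapes tape letter :=
  slides ((Cols c, true) :: [seq (Ruler false e, b) | e <- es]) (Posz p.2)
    (slides ((Rows c, true) :: [seq (Ruler true e, b) | e <- es]) (Posz p.1) s).

Lemma output_for_cells x c es b g s (F : grid x -> seq letter) :
  size (s (Rows c)).1 = row_number x -> size (s (Cols c)).1 = col_number x ->
  (forall p, output g (visit c es b p s) = F p) ->
  output (for_cells c es b g) s = flatten [seq F p | p <- enum {: grid x}].
Proof.
move=> size_rows size_cols body; rewrite flatten_map_prod [LHS]/(flatten _) size_rows mkseq_ord.
congr flatten; apply: eq_map => r; rewrite size_cols mkseq_ord.
by congr flatten; apply: eq_map => j; exact: (body (r, j)).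
Qed.

Lemma readings_visits x (q p p' : grid x) s (i : tape) : (s i).2 = 0%R ->
  readings (visit (Some true) [:: true] true p'
    (visit (Some false) [:: false] true p (visit None [:: false; true] false q s))) i =
  cell (s i).1
    match i with
    | Rows None => Posz q.1
    | Cols None => Posz q.2
    | Ruler v e => if v then (Posz (if e then p' else p).1 - Posz q.1)%R
                   else (Posz (if e then p' else p).2 - Posz q.2)%R
    | Rows (Some e) => Posz (if e then p' else p).1
    | Cols (Some e) => Posz (if e then p' else p).2
    | _ => 0%R
    end.
Proof.
rewrite /readings /visit /slides /= => ->; congr cell.
by case: i => [||||| [[]|] | [[]|] | [] [] | b i]; rewrite /=; ring.
Qed.

Local Notation V := {: vertex m}.
Local Notation Tm := {: time m}.

Definition edge_loop (h : time m) : loop tape letter :=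
  for_cells (Some false) [:: false] true (thens [seq
    for_cells (Some true) [:: true] true (thens [seq Print (edge_bit h g g') | g' <- enum V])
    | g <- enum V]).

Definition edges_loop : loop tape letter :=
  for_cells None [:: false; true] false (thens [seq edge_loop h | h <- enum Tm]).

Definition parameters : seq bool := delimit (binary 2) ++ delimit (binary 0).

Definition output_loop : loop tape letter :=
  for_cells None [::] true (prints (nseq #|V| one)) ;; prints [:: bit false] ;;
  for_cells None [::] true (prints (nseq #|Tm| one)) ;; prints [:: bit false] ;;
  prints (map bit parameters) ;; edges_loop.

Local Notation power_tape b := (fun i => Power b (inord i) : tape).

Definition guess_loop : loop tape letter := unary_polynomial one (power_tape false) cy dy.

Definition length_loop : loop tape letter :=
  For Input [::] (prints [:: one; one]) ;; prints [:: one] ;; For Guess [::] (prints [:: one]).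

Definition horizon_loop : loop tape letter := unary_polynomial one (power_tape true) ct dt.

Definition rows_loop : loop tape letter :=
  prints [:: one] ;; For Horizon [::] (prints [:: bit false]).

Definition input_label (scan : tape -> option letter) : letter :=
  if scan Input is Some (inl b) then lab (InputBit b) else lab LaterRow.

Definition cols_loop : loop tape letter :=
  prints [:: lab LeftBlank] ;; For Horizon [::] (prints [:: lab LeftBlank]) ;;
  For Input [::] (prints [:: lab (InputBit true)] ;; Print input_label) ;;
  prints [:: lab (InputBit false)] ;; For Guess [::] (prints [:: lab FreeBit]) ;;
  prints [:: lab RightBlank] ;; For Horizon [::] (prints [:: lab RightBlank]).

Definition contents (x : seq bool) (i : tape) : seq letter :=
  match i with
  | Input => map bit x
  | Power false i => nseq (size x ^ i) one
  | Guess => nseq (guess (size x)) one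
  | Length => nseq (word_size (size x)) one
  | Power true i => nseq (word_size (size x) ^ i) one
  | Horizon => nseq (horizon (size x)) one
  | Rows _ => one :: nseq (horizon (size x)) (bit false)
  | Cols _ => map lab (top_row x)
  | Ruler _ _ => ruler
  | Output => map bit (tvc_encode (reduct x))
  end.

Section Contents.
Variables (x : seq bool) (c : tape -> seq letter).

Lemma output_guess : c (Power false (inord dy)) = contents x (Power false (inord dy)) ->
  output guess_loop (at_start c) = contents x Guess.
Proof.
move=> c_power; rewrite (@output_unary_polynomial _ _ _ _ _ _ (size x)) //= c_power /=.
by rewrite size_nseq inordK // ltnS leq_addr.
Qed.

Lemma output_horizon : c (Power true (inord dt)) = contents x (Power true (inord dt)) ->
  output horizon_loop (at_start c) = contents x Horizon.
Proof.
move=> c_power; rewrite (@output_unary_polynomial _ _ _ _ _ _ (word_size (size x))) //= c_power.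
by rewrite /= size_nseq inordK // ltnS leq_addl.
Qed.

Lemma output_length : c Input = contents x Input -> c Guess = contents x Guess ->
  output length_loop (at_start c) = contents x Length.
Proof.
move=> c_Input c_Guess; rewrite !(output_for_prints, output_prints, output_then) /=.
rewrite c_Input c_Guess size_map size_nseq -[[:: one; one]]/(nseq 2 one).
rewrite flatten_nseq flatten_nseq1.
by rewrite /word_size -addnA (mulnC 2) !nseqD.
Qed.

Lemma output_rows k : c Horizon = contents x Horizon ->
  output rows_loop (at_start c) = contents x (Rows k).
Proof.
move=> c_Horizon; rewrite output_then output_prints output_for_prints /= c_Horizon.
by rewrite size_nseq flatten_nseq1.
Qed.

Lemma output_cols k : c Input = contents x Input -> c Guess = contents x Guess ->
  c Horizon = contents x Horizon ->
  output cols_loop (at_start c) = contents x (Cols k).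
Proof.
move=> c_Input c_Guess c_Horizon; pose F (b : letter) := [:: lab (InputBit true);
  if b is inl b then lab (InputBit b) else lab LaterRow].
rewrite !(output_for_prints, output_prints, output_then) (output_for (F := F)); last first.
  move=> i b scanned; rewrite output_then output_prints /F; congr [:: _; _].
  rewrite /input_label readings_slides_head //; move: scanned; rewrite /= => ->.
  by case: b.
rewrite /= c_Input c_Guess c_Horizon /top_row /first_row !map_cat !map_nseq !flatten_nseq1.
rewrite /= !size_nseq map_nseq -catA; congr (_ :: _ ++ _ ++ _).
by rewrite !map_flatten -!map_comp.
Qed.

Definition snapshot_bits (t : grid x * time m) : seq bool :=
  flatten [seq [seq reduct_joined t u v | v <- enum {: grid x * vertex m}]
    | u <- enum {: grid x * vertex m}].

Hypothesis c_Rows : forall k, c (Rows k) = contents x (Rows k).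
Hypothesis c_Cols : forall k, c (Cols k) = contents x (Cols k).
Hypothesis c_Ruler : forall v e, c (Ruler v e) = ruler.

Lemma size_Rows k : size (at_start c (Rows k)).1 = row_number x.
Proof. by rewrite /= c_Rows /= size_nseq. Qed.

Lemma size_Cols k : size (at_start c (Cols k)).1 = col_number x.
Proof. by rewrite /= c_Cols size_map. Qed.

Lemma edge_bit_visits (q p p' : grid x) h g g' :
  edge_bit h g g' (readings (visit (Some true) [:: true] true p'
    (visit (Some false) [:: false] true p
      (visit None [:: false; true] false q (at_start c))))) =
  bit (reduct_joined (q, h) (p, g) (p', g')).
Proof.
set scan := readings _.
have label_q : scanned_label scan = cell_label q.
  rewrite /scanned_label /scan !readings_visits // /at_start /= c_Rows c_Cols.
  have -> : contents x (Cols None) = map lab (top_row x) by [].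
  rewrite onth_map (onthE (top_row x)) (nth_map LaterRow) //=.
  rewrite /cell_label /row_label.
  by case: (val q.1) => [|r] //=; rewrite onth_nseq; case: ifP.
by rewrite reduct_joined_local /edge_bit label_q /scan !readings_visits // /at_start /= !c_Ruler.
Qed.

Lemma output_edge_loop q h :
  output (edge_loop h) (visit None [:: false; true] false q (at_start c)) =
  map bit (snapshot_bits (q, h)).
Proof.
rewrite (@output_for_cells x _ _ _ _ _ (fun p => map bit (flatten [seq
  [seq reduct_joined (q, h) (p, g) v | v <- enum {: grid x * vertex m}] | g <- enum V])))
  => [|||p]; [| exact: size_Rows | exact: size_Cols |].
  by rewrite /snapshot_bits [in RHS]flatten_map_prod map_flatten -map_comp.
rewrite output_thens -map_comp map_flatten -map_comp; congr flatten; apply: eq_map => g.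
rewrite [RHS]/comp -map_comp -flatten_map1 flatten_map_prod.
apply: output_for_cells => [||p']; [exact: size_Rows | exact: size_Cols |].
rewrite output_thens -map_comp; congr flatten; apply: eq_map => g'.
by congr [:: _]; exact: edge_bit_visits.
Qed.

Lemma output_output : output output_loop (at_start c) = contents x Output.
Proof.
have count_cells w : output (for_cells None [::] true (prints w)) (at_start c) =
    flatten (nseq #|{: grid x}| w).
  rewrite (@output_for_cells x _ _ _ _ _ (fun=> w) (size_Rows _) (size_Cols _)) => [|p].
    by rewrite map_const_nseq -cardE.
  exact: output_prints.
have unary_bits k : map bit (unary k) = nseq k one ++ [:: bit false].
  by rewrite /unary map_rcons map_nseq cats1.
rewrite !(count_cells, output_prints, output_then) !flatten_nseq.
have -> : contents x Output = map bit (tvc_encode (reduct x)) by [].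
rewrite [tvc_encode _]edge_list_encode [delimit _ ++ _]catA.
rewrite -/parameters !map_cat !unary_bits -!catA.
rewrite [#|{: grid x * vertex m}|]card_prod [#|{: grid x * time m}|]card_prod.
do 5!congr cat.
rewrite (@output_for_cells x _ _ _ _ _
  (fun q => flatten [seq map bit (snapshot_bits (q, h)) | h <- enum Tm])
  (size_Rows _) (size_Cols _)) => [|q].
  by rewrite map_flatten -map_comp [in RHS]flatten_map_prod.
by rewrite output_thens -map_comp; congr flatten; apply: eq_map => h; exact: output_edge_loop.
Qed.

End Contents.

Definition row_tapes : seq tape := [:: Rows None; Rows (Some false); Rows (Some true)].

Definition col_tapes : seq tape := [:: Cols None; Cols (Some false); Cols (Some true)].

Definition ruler_tapes : seq tape :=
  [:: Ruler false false; Ruler false true; Ruler true false; Ruler true true].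

Definition arithmetic_script : script tape letter :=
  powers one Input (power_tape false) dy ++
  [seq (k, guess_loop) | k <- [:: Guess]] ++ [seq (k, length_loop) | k <- [:: Length]] ++
  powers one Length (power_tape true) dt ++ [seq (k, horizon_loop) | k <- [:: Horizon]].

Definition layout_script : script tape letter :=
  [seq (k, rows_loop) | k <- row_tapes] ++ [seq (k, cols_loop) | k <- col_tapes] ++
  [seq (k, prints ruler) | k <- ruler_tapes] ++ [seq (k, output_loop) | k <- [:: Output]].

Lemma uniq_power_tapes b d : d <= dy + dt -> uniq (mkseq (power_tape b) d.+1).
Proof.
move=> le_d; rewrite map_inj_in_uniq ?iota_uniq // => i j.
rewrite !mem_iota /= !add0n => lt_i lt_j.
by case=> /(congr1 val) /=; rewrite !inordK //; lia.
Qed.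

Lemma mem_power_tapes b d (i : tape) :
  (if i is Power b' _ then b' != b else true) -> (i \in mkseq (power_tape b) d) = false.
Proof.
by move=> other; apply/negbTE/mapP => -[j _ Ei]; rewrite Ei eqxx in other.
Qed.

Lemma last_power_tape b d : power_tape b d \in mkseq (power_tape b) d.+1.
Proof. by apply: map_f; rewrite mem_iota leqnn. Qed.

Lemma well_nested_for_cells k moved c es b g :
  well_nested k moved (for_cells c es b g) =
  let rulers v := [seq Ruler v e | e <- es] in
  let moved' := Rows c :: rulers true ++ moved in
  [&& Rows c != k, Rows c \notin moved, Rows c \notin rulers true, k \notin rulers true,
      Cols c != k, Cols c \notin moved', Cols c \notin rulers false, k \notin rulers false
    & well_nested k (Cols c :: rulers false ++ moved') g].
Proof. by rewrite /= /unzip1 -!map_comp. Qed.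

Lemma well_nested_edge_loop h :
  let owner v := [:: Ruler v false; Ruler v true] in
  well_nested Output (Cols None :: owner false ++ Rows None :: owner true) (edge_loop h).
Proof.
rewrite /edge_loop well_nested_for_cells /= well_nested_thens all_map; apply/allP => g _.
rewrite [_ g]well_nested_for_cells /= well_nested_thens all_map; apply/allP => g' _.
by [].
Qed.

Lemma well_nested_output_loop : well_nested Output [::] output_loop.
Proof.
rewrite !(well_nested_prints, well_nested_for_cells, well_nested_then) /=.
rewrite !well_nested_prints well_nested_thens all_map.
by apply/allP => h _; exact: well_nested_edge_loop.
Qed.

Lemma computes_arithmetic x : computes (contents x) [:: Input] arithmetic_script.
Proof.
apply: computes_cat.
  apply: computes_powers; rewrite ?mem_head ?uniq_power_tapes ?leq_addr //.
    by apply/hasPn => _ /mapP[i _ ->].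
  by move=> i le_i; rewrite /= size_map inordK // ltnS (leq_trans le_i) ?leq_addr.
have := last_power_tape false dy; have := @mem_power_tapes false dy.+1.
rewrite unzip1_powers; move: (mkseq _ _) => ps other last_ps.
apply: computes_fills_cat => [//|||w k w_c|].
- by rewrite /= !(mem_cat, inE) other.
- by rewrite /= !well_nested_prints.
- by rewrite inE => /eqP ->; apply/output_guess/w_c; rewrite mem_cat last_ps orbT.
apply: computes_fills_cat => [//||//|w k w_c|].
- by rewrite /= !(mem_cat, inE) other.
- by rewrite inE => /eqP ->; apply: output_length; apply: w_c; rewrite !(mem_cat, inE) ?orbT.
apply: computes_cat.
  apply: computes_powers; rewrite ?mem_cat ?inE ?orbT ?uniq_power_tapes ?leq_addl //.
    by apply/hasPn => _ /mapP[i _ ->]; rewrite /= !(mem_cat, inE) other.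
  by move=> i le_i; rewrite /= size_nseq inordK // ltnS (leq_trans le_i) ?leq_addl.
have := last_power_tape true dt; have := @mem_power_tapes true dt.+1.
rewrite unzip1_powers; move: (mkseq _ _) => qs other' last_qs.
rewrite -[map _ _]cats0; apply: computes_fills_cat => [//|||w k w_c|//].
- by rewrite /= !(mem_cat, inE) other ?other'.
- by rewrite /= !well_nested_prints.
- by rewrite inE => /eqP ->; apply/output_horizon/w_c; rewrite mem_cat last_qs orbT.
Qed.

Lemma computes_layout x (filled : seq tape) :
  Input \in filled -> Guess \in filled -> Horizon \in filled ->
  ~~ has (mem filled) (row_tapes ++ col_tapes ++ ruler_tapes ++ [:: Output]) ->
  computes (contents x) filled layout_script.
Proof.
move=> Input_filled Guess_filled Horizon_filled; rewrite 3!has_cat.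
move=> /norP[rows /norP[cols /norP[rulers out]]].
have new s s' : ~~ has (mem s) s' -> ~~ has (mem filled) s' -> ~~ has (mem (filled ++ s)) s'.
  move=> /hasPn s_s' /hasPn filled_s'; apply/hasPn => i i_s'.
  by rewrite /= mem_cat negb_or filled_s' ?s_s'.
apply: computes_fills_cat => [//||//|w k w_c|]; first exact: rows.
  by rewrite /row_tapes !inE => /or3P[] /eqP ->; apply: output_rows; apply: w_c.
apply: computes_fills_cat => [//||//|w k w_c|]; first exact: new.
  rewrite /col_tapes !inE => /or3P[] /eqP ->; apply: output_cols; apply: w_c;
  by rewrite mem_cat ?Input_filled ?Guess_filled ?Horizon_filled.
rewrite -catA; apply: computes_fills_cat => [//||//|w k w_c|]; first exact: new.
  by rewrite output_prints /ruler_tapes !inE => /or4P[] /eqP ->.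
rewrite -catA -[map _ _]cats0; apply: computes_fills_cat => [//|||w k w_c|//]; first exact: new.
  by rewrite all_seq1 well_nested_output_loop.
rewrite inE => /eqP ->; apply: output_output => [[[]|]|[[]|]|[] []]; apply: w_c;
  by rewrite !(mem_cat, inE) ?orbT.
Qed.

Lemma reduction_computes x :
  computes (contents x) [:: Input] (arithmetic_script ++ layout_script).
Proof.
apply: computes_cat (computes_arithmetic x) _; rewrite /arithmetic_script /unzip1 !map_cat.
have := @mem_power_tapes false dy.+1; have := @mem_power_tapes true dt.+1.
rewrite -!/(unzip1 _) !unzip1_powers.
move: (mkseq _ dt.+1) (mkseq _ dy.+1) => qs ps qs_other other.
apply: computes_layout; rewrite ?mem_cat ?inE ?orbT //.
by rewrite /= !(mem_cat, inE) !other ?qs_other.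
Qed.

Lemma reduct_polynomial_time : polynomial_time (fun x => tvc_encode (reduct x)).
Proof.
apply: (@script_polynomial_time _ _ bit Input Output _ contents); last exact: reduction_computes.
- by move=> b b' [].
- by [].
- by rewrite /unzip1 !map_cat !mem_cat !inE eqxx !orbT.
- by [].
- by [].
Qed.

Lemma reduct_imw x : imw (tvc_graph (reduct x)) = 4.
Proof.
apply: gadget_imw; split; first exact: ord0.
by apply: (@Ordinal _ 0); rewrite /top_row size_first_row.
Qed.

Lemma reduct_each_edge_once x : each_edge_once (tvc_graph (reduct x)).
Proof. exact: gadget_each_edge_once. Qed.

Lemma reduct_degree x v : underlying_degree (tvc_graph (reduct x)) v <= 28.
Proof. exact/gadget_degree/grid_next_inj. Qed.

Lemma reduct_yes x : 0 < m -> tvc_yes (reduct x) <->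
  exists tau, is_tiling conflict (@grid_next _ _) (fun p : grid x => forbid (cell_label p)) tau.
Proof. exact: gadget_yes (@grid_next_neq _ _) (@grid_next_inj _ _). Qed.

Lemma time_le_horizon x y : size y <= guess (size x) ->
  ct * size (pair_code x y) ^ dt + ct <= horizon (size x).
Proof.
move=> le_y; rewrite leq_add2r leq_mul2l; apply/orP; right.
have le_word : size (pair_code x y) <= word_size (size x).
  by rewrite size_cat size_delimit leq_add2l.
by case: (posnP dt) => [->|dt_gt0]; rewrite ?expn0 ?leq_exp2r.
Qed.

End Reduction.

Theorem theorem4p7 :
  exists Delta : nat,
    NP_hard_on (P := timeline_vertex_cover)
      (fun I : tvc_instance =>
         [/\ tvc_k I = 2,
             tvc_l I = 0,
             imw (tvc_graph I) = 4,
             each_edge_once (tvc_graph I)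
           & forall v, underlying_degree (tvc_graph I) v <= Delta]).
Proof.
exists 28 => L [V [cy [dy [[M [ct [dt V_time]]] L_verified]]]].
exists (reduct (@tile_conflict M) (@tile_forbidden M) cy dy ct dt); split=> [|x|x].
- exact: reduct_polynomial_time.
- by split=> //; [exact: reduct_imw | exact: reduct_each_edge_once | exact: reduct_degree].
have tiles_gt0 : 0 < #|{: tile M}| by apply/card_gt0P; exists (blank_tile M).
have tiling_tableau := tableau_tiling M (horizon cy dy ct dt (size x)) (guess cy dy (size x)) x.
have tableau_run := tableauP V_time (@time_le_horizon cy dy ct dt x).
apply: iff_trans (L_verified x) _; apply: iff_sym.
apply: iff_trans (reduct_yes _ _ _ _ _ _ _ tiles_gt0) _.
exact: iff_trans tiling_tableau tableau_run.
Qed.
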